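(* Let $(H,\alpha)$ be a monoidal Hom-Hopf algebra over a field $k$ with antipode $S$. Let $(H^{op},\alpha)$ act on the left on $(H,\alpha)$ by $$\cdot:H^{op}\otimes H\to H,\qquad h\cdot a=\sum(S(h_{1})\alpha^{-1}(a))\alpha(h_{2}),$$ and let $(H,\alpha)$ coact on the right on $(H^{op},\alpha)$ by $$\rho:H^{op}\to H^{op}\otimes H,\qquad \rho(h)=\sum h_{(0)}\otimes h_{(1)}=\sum\alpha(h_{12})\otimes S(h_{11})\alpha^{-1}(h_{2}),$$ where the products on the right-hand sides are taken in $H$. Then we have the Majid's bicrossproduct monoidal Hom-Hopf algebra $(H\ast H^{op},\alpha\ast\alpha)$, that is, the Majid's bicrossproduct $(B\#K,\beta\#\kappa)$ formed from this action and coaction with $(B,\beta)=(H,\alpha)$ and $(K,\kappa)=(H^{op},\alpha)$ is a monoidal Hom-Hopf algebra.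
   Context: All vector spaces, tensor products and linear maps are over a fixed field $k$; Sweedler notation $\Delta(c)=\sum c_1\otimes c_2$ is used, with $\sum h_{11}\otimes h_{12}=\Delta(h_1)$ etc. Monoidal Hom-algebra $(A,\alpha)$: a vector space $A$ with a linear automorphism $\alpha$, a linear multiplication $a\otimes b\mapsto ab$ and an element $1_A$ with $\alpha(a)(bc)=(ab)\alpha(c)$, $a1_A=\alpha(a)=1_Aa$, $\alpha(ab)=\alpha(a)\alpha(b)$, $\alpha(1_A)=1_A$. Monoidal Hom-coalgebra $(C,\gamma)$: a vector space $C$ with a linear automorphism $\gamma$ and linear maps $\Delta:C\to C\otimes C$, $\varepsilon:C\to k$ with $\sum\gamma^{-1}(c_1)\otimes\Delta(c_2)=\sum\Delta(c_1)\otimes\gamma^{-1}(c_2)$, $\sum c_1\varepsilon(c_2)=\sum\varepsilon(c_1)c_2=\gamma^{-1}(c)$, $\Delta(\gamma(c))=\sum\gamma(c_1)\otimes\gamma(c_2)$, $\varepsilon(\gamma(c))=\varepsilon(c)$. Monoidal Hom-bialgebra: $(H,\alpha)$ which is both a monoidal Hom-algebra and a monoidal Hom-coalgebra (same $\alpha$), with $\Delta$ and $\varepsilon$ multiplicative and unital (componentwise product on $H\otimes H$). Monoidal Hom-Hopf algebra: a monoidal Hom-bialgebra with a linear map $S:H\to H$ (antipode) such that $S\alpha=\alpha S$ and $\sum S(h_1)h_2=\varepsilon(h)1=\sum h_1S(h_2)$. $(H^{op},\alpha)$ is $H$ with product $h\circ k=kh$ and the same unit, coproduct, counit and $\alpha$.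 Left $(K,\kappa)$-Hom-module $(M,\mu)$: $\mu$ a linear automorphism of $M$ and a linear map $K\otimes M\to M$ with $\kappa(h)\cdot(g\cdot m)=(hg)\cdot\mu(m)$, $1\cdot m=\mu(m)$, $\mu(h\cdot m)=\kappa(h)\cdot\mu(m)$. A left $(K,\kappa)$-Hom-module algebra is a monoidal Hom-algebra $(B,\beta)$ that is a left Hom-module (with automorphism $\beta$) with $h\cdot(ab)=\sum(h_1\cdot a)(h_2\cdot b)$, $h\cdot1_B=\varepsilon(h)1_B$. Right $(B,\beta)$-Hom-comodule $(M,\mu)$: $\mu$ a linear automorphism of $M$ and a linear map $\rho:M\to M\otimes B$, $\rho(m)=\sum m_{(0)}\otimes m_{(1)}$, with $\sum\mu^{-1}(m_{(0)})\otimes\Delta(m_{(1)})=\sum\rho(m_{(0)})\otimes\beta^{-1}(m_{(1)})$, $\sum\varepsilon(m_{(1)})m_{(0)}=\mu^{-1}(m)$, $\rho(\mu(m))=\sum\mu(m_{(0)})\otimes\beta(m_{(1)})$. A right $(B,\beta)$-Hom-comodule coalgebra is a monoidal Hom-coalgebra $(C,\gamma)$ that is a right $(B,\beta)$-Hom-comodule (with automorphism $\gamma$) with $\sum c_{(0)1}\otimes c_{(0)2}\otimes c_{(1)}=\sum c_{1(0)}\otimes c_{2(0)}\otimes c_{1(1)}c_{2(1)}$ and $\sum\varepsilon(c_{(0)})c_{(1)}=\varepsilon(c)1_B$. Majid's bicrossproduct: given monoidal Hom-Hopf algebras $(B,\beta)$ and $(K,\kappa)$, with antipodes $S_B$ and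 $S_K$, such that $(B,\beta)$ is a left $(K,\kappa)$-Hom-module algebra and $(K,\kappa)$ is a right $(B,\beta)$-Hom-comodule coalgebra, $B\#K$ is the vector space $B\otimes K$ (with $a\#h:=a\otimes h$), twisting automorphism $\beta\#\kappa=\beta\otimes\kappa$, with product $(a\#h)(b\#k)=\sum a(h_{1}\cdot\beta^{-1}(b))\#\kappa(h_{2})k$, unit $1_B\#1_K$, coproduct $\Delta(a\#h)=\sum a_{1}\#\kappa(h_{1(0)})\otimes\beta^{-1}(a_{2})h_{1(1)}\# h_{2}$, counit $\varepsilon_B\otimes\varepsilon_K$, and antipode $S(a\#h)=\sum(1_{B}\#S_{K}(h_{(0)}))(S_{B}(\beta^{-2}(a)\beta^{-1}(h_{(1)}))\#1_{K})$. It is called a Majid's bicrossproduct monoidal Hom-Hopf algebra when these structures make it a monoidal Hom-Hopf algebra.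
   Formalization: The antipode of the bicrossproduct uses an antipode of H^op, which exists only when S is bijective; the formal theorem assumes such an S_K for the Hopf conclusion only, while the action, coaction and bialgebra claims hold for every H. *)

(* Defs.v *)
From HB Require Import structures.
From mathcomp Require Import all_boot all_order all_algebra.
From mathcomp Require Import boolp.

Set Implicit Arguments.
Unset Strict Implicit.
Unset Printing Implicit Defensive.
Import GRing.Theory.
Local Open Scope ring_scope.
Local Open Scope quotient_scope.

Reserved Notation "x ⊗ y" (at level 40, left associativity).
Reserved Notation "\sw_ ( x , y <- t ) F"
  (at level 41, F at level 41, x name, y name, t at level 200,
   format "'[' \sw_ ( x ,  y  <-  t ) '/  '  F ']'").

Definition is_bilinear (k : fieldType) (M N W : lmodType k) (f : M -> N -> W) :
    Prop :=
  (forall y, linear (f^~ y)) /\ (forall x, linear (f x)).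

(* The tensor product over k of two vector spaces of arbitrary dimension:
   finite formal sums of pairs, two of them being identified when no bilinear
   map out of M x N separates them.  The universal property is given by
   tens_bilinear, tensor_sum_linear, tensor_sum_tens and tensor_span. *)
Section Tensor.
Variables (k : fieldType) (M N : lmodType k).
Implicit Type s : seq (M * N).

Definition tensor_rel (s t : seq (M * N)) : bool :=
  `[< forall (W : lmodType k) (f : M -> N -> W), is_bilinear f ->
      \sum_(p <- s) f p.1 p.2 = \sum_(p <- t) f p.1 p.2 >].

Lemma tensor_rel_refl : reflexive tensor_rel.
Proof. by move=> s; apply/asboolP. Qed.

Lemma tensor_rel_sym : symmetric tensor_rel.
Proof.
by move=> s t; apply/asboolP/asboolP => st W f bf; rewrite (st W f bf).
Qed.

Lemma tensor_rel_trans : transitive tensor_rel.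
Proof.
move=> t s u /asboolP st /asboolP tu; apply/asboolP => W f bf.
by rewrite st ?tu.
Qed.

Canonical tensor_equiv :=
  EquivRel tensor_rel tensor_rel_refl tensor_rel_sym tensor_rel_trans.

Definition tensor := {eq_quot tensor_rel}.

HB.instance Definition _ : EqQuotient _ tensor_rel tensor := EqQuotient.on tensor.
HB.instance Definition _ := Choice.on tensor.

Implicit Types t u v : tensor.

Definition tens (x : M) (y : N) : tensor := \pi_tensor [:: (x, y)].

(* Meaningful for bilinear f: the value then does not depend on the
   representative of t as a sum of pure tensors. *)
Definition tensor_sum (W : lmodType k) (f : M -> N -> W) (t : tensor) : W :=
  \sum_(p <- repr t) f p.1 p.2.

Lemma tensor_sum_pi (W : lmodType k) (f : M -> N -> W) s :
  is_bilinear f -> tensor_sum f (\pi_tensor s) = \sum_(p <- s) f p.1 p.2.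
Proof.
move=> bf; rewrite /tensor_sum.
have /eqmodP/asboolP h : repr (\pi_tensor s) = s %[mod tensor] by rewrite reprK.
exact: h.
Qed.

Lemma tensorP (t u : tensor) :
  (forall (W : lmodType k) (f : M -> N -> W), is_bilinear f ->
     tensor_sum f t = tensor_sum f u) -> t = u.
Proof.
move=> h; rewrite -[t]reprK -[u]reprK; apply/eqmodP/asboolP => W f bf.
exact: (h W f bf).
Qed.

Definition tensor_zero : tensor := \pi_tensor [::].
Definition tensor_add (t u : tensor) : tensor := \pi_tensor (repr t ++ repr u).
Definition tensor_scale (a : k) (t : tensor) : tensor :=
  \pi_tensor [seq (a *: p.1, p.2) | p <- repr t].
Definition tensor_opp (t : tensor) : tensor := tensor_scale (- 1) t.

Section TensorSum.
Variables (W : lmodType k) (f : M -> N -> W).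
Hypothesis bf : is_bilinear f.

Lemma tensor_sum_zero : tensor_sum f tensor_zero = 0.
Proof. by rewrite tensor_sum_pi // big_nil. Qed.

Lemma tensor_sum_add t u :
  tensor_sum f (tensor_add t u) = tensor_sum f t + tensor_sum f u.
Proof. by rewrite tensor_sum_pi // big_cat. Qed.

Lemma tensor_sum_scale a t :
  tensor_sum f (tensor_scale a t) = a *: tensor_sum f t.
Proof.
rewrite tensor_sum_pi // big_map scaler_sumr; apply: eq_bigr => p _ /=.
exact: (scalable_linear (bf.1 p.2)).
Qed.

Lemma tensor_sum_opp t : tensor_sum f (tensor_opp t) = - tensor_sum f t.
Proof. by rewrite tensor_sum_scale scaleN1r. Qed.

End TensorSum.

Let tensor_sumE :=
  (tensor_sum_zero, tensor_sum_add, tensor_sum_opp, tensor_sum_scale).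

Lemma tensor_addA : associative tensor_add.
Proof. by move=> t u v; apply: tensorP => W f bf; rewrite !tensor_sumE // addrA. Qed.

Lemma tensor_addC : commutative tensor_add.
Proof. by move=> t u; apply: tensorP => W f bf; rewrite !tensor_sumE // addrC. Qed.

Lemma tensor_add0 : left_id tensor_zero tensor_add.
Proof. by move=> t; apply: tensorP => W f bf; rewrite !tensor_sumE // add0r. Qed.

Lemma tensor_addN : left_inverse tensor_zero tensor_opp tensor_add.
Proof. by move=> t; apply: tensorP => W f bf; rewrite !tensor_sumE // addNr. Qed.

HB.instance Definition _ :=
  GRing.isZmodule.Build tensor tensor_addA tensor_addC tensor_add0 tensor_addN.

Lemma tensor_scaleA a b t :
  tensor_scale a (tensor_scale b t) = tensor_scale (a * b) t.
Proof. by apply: tensorP => W f bf; rewrite !tensor_sumE // scalerA. Qed.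

Lemma tensor_scale1 : left_id 1 tensor_scale.
Proof. by move=> t; apply: tensorP => W f bf; rewrite !tensor_sumE // scale1r. Qed.

Lemma tensor_scaleDr : right_distributive tensor_scale +%R.
Proof.
by move=> a t u; apply: tensorP => W f bf; rewrite !tensor_sumE // scalerDr.
Qed.

Lemma tensor_scaleDl t : {morph tensor_scale^~ t : a b / a + b}.
Proof.
by move=> a b; apply: tensorP => W f bf; rewrite !tensor_sumE // scalerDl.
Qed.

HB.instance Definition _ := GRing.Zmodule_isLmodule.Build k tensor
  tensor_scaleA tensor_scale1 tensor_scaleDr tensor_scaleDl.

Lemma tensor_sum_linear (W : lmodType k) (f : M -> N -> W) :
  is_bilinear f -> linear (tensor_sum f).
Proof. by move=> bf a t u; rewrite tensor_sum_add // tensor_sum_scale. Qed.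

Lemma tensor_sum_tens (W : lmodType k) (f : M -> N -> W) x y :
  is_bilinear f -> tensor_sum f (tens x y) = f x y.
Proof. by move=> bf; rewrite tensor_sum_pi // big_seq1. Qed.

Lemma tens_bilinear : is_bilinear tens.
Proof.
split=> [y a x1 x2|x a y1 y2]; apply: tensorP => W f bf;
  rewrite tensor_sum_linear // !tensor_sum_tens //.
- exact: bf.1.
- exact: bf.2.
Qed.

Lemma tensor_span (t : tensor) : t = \sum_(p <- repr t) tens p.1 p.2.
Proof.
apply: tensorP => W f bf; rewrite {1}/tensor_sum.
elim: (repr t) => [|p s IHs]; first by rewrite !big_nil tensor_sum_zero.
rewrite !big_cons -[tens _ _ in RHS]scale1r tensor_sum_linear //.
by rewrite scale1r tensor_sum_tens // IHs.
Qed.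

End Tensor.

Arguments tensor {k} M N.
Arguments tens {k M N} x y.
Arguments tensor_sum {k M N W} f t.

Notation "M ⊗ N" := (tensor M%type N%type) : type_scope.
Notation "x ⊗ y" := (tens x y) : ring_scope.
(* Sweedler notation: the sum of F over t = \sum x ⊗ y. *)
Notation "\sw_ ( x , y <- t ) F" := (tensor_sum (fun x y => F) t) : ring_scope.

Definition is_automorphism (k : fieldType) (M : lmodType k) (mu muV : M -> M) :
    Prop :=
  [/\ linear mu, cancel mu muV & cancel muV mu].

(* The operations carried by a monoidal Hom-bialgebra, without their axioms.
   The inverse of the twisting automorphism is part of the data; it is pinned
   down by is_automorphism. *)
Record hom_ops (k : fieldType) := HomOps {
  carrier :> lmodType k;
  twist : carrier -> carrier;
  twistV : carrier -> carrier;
  hmul : carrier -> carrier -> carrier;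
  hunit : carrier;
  comul : carrier -> carrier ⊗ carrier;
  counit : carrier -> k }.

Arguments twist {k h} _.
Arguments twistV {k h} _.
Arguments hmul {k h} _ _.
Arguments hunit {k} h.
Arguments comul {k h} _.
Arguments counit {k h} _.

(* Below, triple tensors are bracketed to the right on both sides of an
   equation: the associativity isomorphism is absorbed by naming all three
   factors. *)

Record is_hom_algebra (k : fieldType) (A : hom_ops k) : Prop := IsHomAlgebra {
  alg_twist_aut : is_automorphism (@twist k A) twistV;
  mul_bilinear : is_bilinear (@hmul k A);
  mul_hom_assoc : forall a b c : A,
    hmul (twist a) (hmul b c) = hmul (hmul a b) (twist c);
  mul_unitr : forall a : A, hmul a (hunit A) = twist a;
  mul_unitl : forall a : A, hmul (hunit A) a = twist a;
  twist_mul : forall a b : A, twist (hmul a b) = hmul (twist a) (twist b);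
  twist_unit : twist (hunit A) = hunit A }.

Record is_hom_coalgebra (k : fieldType) (C : hom_ops k) : Prop :=
    IsHomCoalgebra {
  coalg_twist_aut : is_automorphism (@twist k C) twistV;
  comul_linear : linear (@comul k C);
  counit_linear : scalar (@counit k C);
  comul_hom_coassoc : forall c : C,
    \sw_(c1, c2 <- comul c) \sw_(c21, c22 <- comul c2)
      (twistV c1 ⊗ (c21 ⊗ c22)) =
    \sw_(c1, c2 <- comul c) \sw_(c11, c12 <- comul c1)
      (c11 ⊗ (c12 ⊗ twistV c2));
  comul_counitr : forall c : C,
    \sw_(c1, c2 <- comul c) (counit c2 *: c1) = twistV c;
  comul_counitl : forall c : C,
    \sw_(c1, c2 <- comul c) (counit c1 *: c2) = twistV c;
  comul_twist : forall c : C,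
    comul (twist c) = \sw_(c1, c2 <- comul c) (twist c1 ⊗ twist c2);
  counit_twist : forall c : C, counit (twist c) = counit c }.

Record is_hom_bialgebra (k : fieldType) (H : hom_ops k) : Prop :=
    IsHomBialgebra {
  bialg_algebra : is_hom_algebra H;
  bialg_coalgebra : is_hom_coalgebra H;
  comul_mul : forall a b : H,
    comul (hmul a b) =
    \sw_(a1, a2 <- comul a) \sw_(b1, b2 <- comul b) (hmul a1 b1 ⊗ hmul a2 b2);
  comul_unit : comul (hunit H) = hunit H ⊗ hunit H;
  counit_mul : forall a b : H, counit (hmul a b) = counit a * counit b;
  counit_unit : counit (hunit H) = 1 }.

Record is_antipode (k : fieldType) (H : hom_ops k) (S : H -> H) : Prop :=
    IsAntipode {
  antipode_linear : linear S;
  antipode_twist : forall h : H, S (twist h) = twist (S h);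
  antipode_mull : forall h : H,
    \sw_(h1, h2 <- comul h) hmul (S h1) h2 = counit h *: hunit H;
  antipode_mulr : forall h : H,
    \sw_(h1, h2 <- comul h) hmul h1 (S h2) = counit h *: hunit H }.

Arguments is_antipode {k} H S.

Definition is_hom_hopf (k : fieldType) (H : hom_ops k) (S : H -> H) : Prop :=
  is_hom_bialgebra H /\ is_antipode H S.

Arguments is_hom_hopf {k} H S.

Definition hop (k : fieldType) (H : hom_ops k) : hom_ops k :=
  {| carrier := H; twist := twist; twistV := twistV;
     hmul := fun h g : H => hmul g h; hunit := hunit H;
     comul := comul; counit := counit |}.

Record is_hom_module (k : fieldType) (K : hom_ops k) (M : lmodType k)
    (mu muV : M -> M) (act : K -> M -> M) : Prop := IsHomModule {
  mod_aut : is_automorphism mu muV;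
  act_bilinear : is_bilinear act;
  act_mul : forall (h g : K) (m : M),
    act (twist h) (act g m) = act (hmul h g) (mu m);
  act_unit : forall m : M, act (hunit K) m = mu m;
  act_twist : forall (h : K) (m : M), mu (act h m) = act (twist h) (mu m) }.

Arguments is_hom_module {k} K M mu muV act.

Record is_hom_module_algebra (k : fieldType) (K B : hom_ops k)
    (act : K -> B -> B) : Prop := IsHomModuleAlgebra {
  modalg_algebra : is_hom_algebra B;
  modalg_module : is_hom_module K B twist twistV act;
  act_algmul : forall (h : K) (a b : B),
    act h (hmul a b) = \sw_(h1, h2 <- comul h) hmul (act h1 a) (act h2 b);
  act_algunit : forall h : K, act h (hunit B) = counit h *: hunit B }.

Arguments is_hom_module_algebra {k} K B act.

Record is_hom_comodule (k : fieldType) (B : hom_ops k) (M : lmodType k)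
    (mu muV : M -> M) (rho : M -> M ⊗ B) : Prop := IsHomComodule {
  comod_aut : is_automorphism mu muV;
  coact_linear : linear rho;
  coact_comul : forall m : M,
    \sw_(m0, m1 <- rho m) \sw_(m11, m12 <- comul m1)
      (muV m0 ⊗ (m11 ⊗ m12)) =
    \sw_(m0, m1 <- rho m) \sw_(m00, m01 <- rho m0)
      (m00 ⊗ (m01 ⊗ twistV m1));
  coact_counit : forall m : M,
    \sw_(m0, m1 <- rho m) (counit m1 *: m0) = muV m;
  coact_twist : forall m : M,
    rho (mu m) = \sw_(m0, m1 <- rho m) (mu m0 ⊗ twist m1) }.

Arguments is_hom_comodule {k} B M mu muV rho.

Record is_hom_comodule_coalgebra (k : fieldType) (B C : hom_ops k)
    (rho : C -> C ⊗ B) : Prop := IsHomComoduleCoalgebra {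
  comodcoalg_coalgebra : is_hom_coalgebra C;
  comodcoalg_comodule : is_hom_comodule B C twist twistV rho;
  coact_coalgmul : forall c : C,
    \sw_(c0, c1 <- rho c) \sw_(c01, c02 <- comul c0)
      (c01 ⊗ (c02 ⊗ c1)) =
    \sw_(c1, c2 <- comul c) \sw_(c10, c11 <- rho c1) \sw_(c20, c21 <- rho c2)
      (c10 ⊗ (c20 ⊗ hmul c11 c21));
  coact_coalgcounit : forall c : C,
    \sw_(c0, c1 <- rho c) (counit c0 *: c1) = counit c *: hunit B }.

Arguments is_hom_comodule_coalgebra {k} B C rho.

Section Bicrossproduct.
Variables (k : fieldType) (B K : hom_ops k).
Variables (act : K -> B -> B) (rho : K -> K ⊗ B).

Definition bicross_mul (x y : B ⊗ K) : B ⊗ K :=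
  \sw_(a, h <- x) \sw_(b, g <- y) \sw_(h1, h2 <- comul h)
    (hmul a (act h1 (twistV b)) ⊗ hmul (twist h2) g).

Definition bicross_comul (x : B ⊗ K) : ((B ⊗ K) ⊗ (B ⊗ K))%type :=
  \sw_(a, h <- x) \sw_(a1, a2 <- comul a) \sw_(h1, h2 <- comul h)
  \sw_(h10, h11 <- rho h1)
    ((a1 ⊗ twist h10) ⊗ (hmul (twistV a2) h11 ⊗ h2)).

Definition bicross : hom_ops k :=
  {| carrier := (B ⊗ K)%type : lmodType k;
     twist := fun x : B ⊗ K => \sw_(a, h <- x) (twist a ⊗ twist h);
     twistV := fun x : B ⊗ K => \sw_(a, h <- x) (twistV a ⊗ twistV h);
     hmul := bicross_mul;
     hunit := hunit B ⊗ hunit K;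
     comul := bicross_comul;
     counit :=
       tensor_sum (W := k^o) (fun (a : B) (h : K) => counit a * counit h) |}.

Definition bicross_antipode (SB : B -> B) (SK : K -> K) (x : bicross) :
    bicross :=
  \sw_(a, h <- x) \sw_(h0, h1 <- rho h)
    bicross_mul (hunit B ⊗ SK h0)
                (SB (hmul (twistV (twistV a)) (twistV h1)) ⊗ hunit K).

Record is_majid_bicrossproduct_hopf (SB : B -> B) (SK : K -> K) : Prop :=
    IsMajidBicrossproductHopf {
  majid_hopfl : is_hom_hopf B SB;
  majid_hopfr : is_hom_hopf K SK;
  majid_module_algebra : is_hom_module_algebra K B act;
  majid_comodule_coalgebra : is_hom_comodule_coalgebra B K rho;
  majid_hopf : is_hom_hopf bicross (bicross_antipode SB SK) }.

End Bicrossproduct.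

Section Adjoint.
Variables (k : fieldType) (H : hom_ops k) (S : H -> H).

Definition adj_act (h : hop H) (a : H) : H :=
  \sw_(h1, h2 <- comul (h : H)) hmul (hmul (S h1) (twistV a)) (twist h2).

Definition adj_coact (h : hop H) : hop H ⊗ H :=
  \sw_(h1, h2 <- comul (h : H)) \sw_(h11, h12 <- comul h1)
    ((twist h12 : hop H) ⊗ hmul (S h11) (twistV h2)).

End Adjoint.

Arguments adj_act {k H} S h a.
Arguments adj_coact {k H} S h.
Arguments bicross {k B K} act rho.
Arguments is_majid_bicrossproduct_hopf {k B K} act rho SB SK.

(* Main.v *)
(* Rescaling the product by the inverse of the twist and the coproduct by the
   twist turns H into an ordinary Hopf algebra (product [⊙], coproduct [δ]) of
   which the twist is an automorphism; all Sweedler computations take place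
   there.  The action S(h1) a h2 is inner and the coaction h2 ⊗ S(h1) h3 is
   coinner, so a ⊗ h |-> a h1 ⊗ h2 is an isomorphism from the tensor product
   H ⊗ H^op onto the bicrossproduct, compatible with products and coproducts;
   the bialgebra axioms are transported along it.  On the image of a ⊗ h the
   antipode is (1 ⊗ S_K(h1)) (S(a h2) ⊗ 1), from which its axioms follow. *)

(* Two cancellations of h1 S(h2) carry the argument: innerness, h1 (S(h2) b h3) = b h, and its dual,
   h3 ⊗ h1 S(h2) h4 = h1 ⊗ h2. The first makes a ⊗ h |-> a h1 ⊗ h2 multiplicative, the second makes
   it comultiplicative and also strips the coaction from the antipode formula on its image.
   Inserting them backwards gives the laws that mix the action with products and the coaction with
   coproducts. Transport avoids a head-on check of the bicrossproduct axioms, where action and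
   coaction get nested; the worst of these, multiplicativity of the coproduct, becomes the
   componentwise statement on H ⊗ H^op. The antipode is prescribed by a formula, so its laws are
   verified for that formula directly, after a change of variable along the isomorphism. *)
Require Import Defs.
From HB Require Import structures.
From mathcomp Require Import all_boot all_order all_algebra.
From mathcomp Require Import boolp.

Set Implicit Arguments.
Unset Strict Implicit.
Unset Printing Implicit Defensive.
Import GRing.Theory.
Local Open Scope ring_scope.

(** * Multilinear maps *)

Section Linear.
Variable k : fieldType.
Implicit Types M N P Q V W : lmodType k.

(** [linear] and [scalar] are both notations for [linear_for]; a constant of its own lets [lin] and
    the hints recognise vector-valued goals by their head. *)
Definition is_linear M W (f : M -> W) : Prop := linear f.

Definition is_trilinear M N P W (F : M -> N -> P -> W) : Prop :=
  [/\ forall y z, is_linear (fun x => F x y z),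
      forall x z, is_linear (fun y => F x y z) &
      forall x y, is_linear (F x y)].

Lemma linear_add M W (f : M -> W) : is_linear f -> {morph f : x y / x + y}.
Proof. by move=> lf x y; have := lf 1 x y; rewrite !scale1r. Qed.

Lemma linear_zero M W (f : M -> W) : is_linear f -> f 0 = 0.
Proof.
by move=> lf; apply: (addIr (f 0)); rewrite add0r -(linear_add lf) addr0.
Qed.

Lemma linear_scale M W (f : M -> W) : is_linear f ->
  forall a x, f (a *: x) = a *: f x.
Proof. by move=> lf a x; rewrite -[a *: x]addr0 lf (linear_zero lf) addr0. Qed.

(** A Sweedler sum is by definition a finite sum over a representative of [t], so additivity moves
    [L] inside. *)
Lemma linear_tensor_sum M N V W (L : V -> W) (F : M -> N -> V) t :
  is_linear L -> L (tensor_sum F t) = \sw_(x, y <- t) L (F x y).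
Proof.
move=> lL; exact: (big_morph L (linear_add lL) (linear_zero lL)).
Qed.

Lemma eq_tensor_sum M N W (F G : M -> N -> W) t :
  (forall x y, F x y = G x y) -> tensor_sum F t = tensor_sum G t.
Proof. by move=> FG; apply: eq_bigr => p _. Qed.

Lemma exchange_tensor_sum M N P Q W (F : M -> N -> P -> Q -> W) t u :
  \sw_(x, y <- t) \sw_(z, w <- u) F x y z w =
  \sw_(z, w <- u) \sw_(x, y <- t) F x y z w.
Proof. exact: exchange_big. Qed.

Lemma tensor_sum_scaler M N W (F : M -> N -> W) a t :
  \sw_(x, y <- t) (a *: F x y) = a *: tensor_sum F t.
Proof. by rewrite /tensor_sum scaler_sumr. Qed.

Lemma linear_id M : is_linear (fun x : M => x).
Proof. by []. Qed.

Lemma linear_comp M N W (g : N -> W) (f : M -> N) :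
  is_linear g -> is_linear f -> is_linear (fun x => g (f x)).
Proof. by move=> lg lf a x y; rewrite lf lg. Qed.

Lemma linear_binl M N P W (op : N -> P -> W) (f : M -> N) z :
  is_bilinear op -> is_linear f -> is_linear (fun x => op (f x) z).
Proof. by move=> bo lf a x y; rewrite lf (bo.1 z). Qed.

Lemma linear_binr M N P W (op : P -> N -> W) (f : M -> N) z :
  is_bilinear op -> is_linear f -> is_linear (fun x => op z (f x)).
Proof. by move=> bo lf a x y; rewrite lf (bo.2 z). Qed.

Lemma linear_sum_body M N P W (F : M -> N -> P -> W) t :
  (forall y z, is_linear (fun x => F x y z)) ->
  is_linear (fun x => tensor_sum (F x) t).
Proof.
move=> lF a x y; rewrite /tensor_sum scaler_sumr -big_split /=.
by apply: eq_bigr => p _; rewrite lF.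
Qed.

Lemma linear_sum_tensor M N P W (F : N -> P -> W) (t : M -> N ⊗ P) :
  is_bilinear F -> is_linear t -> is_linear (fun x => tensor_sum F (t x)).
Proof. by move=> bF lt a x y; rewrite lt tensor_sum_linear. Qed.

Lemma linear_scaler M W (f : M -> W) a :
  is_linear f -> is_linear (fun x => a *: f x).
Proof. by move=> lf b x y; rewrite lf scalerDr !scalerA mulrC. Qed.

Lemma linear_scalel M W (f : M -> k) v :
  scalar f -> is_linear (fun x => f x *: v : W).
Proof. by move=> lf b x y; rewrite lf scalerDl scalerA. Qed.

Lemma scalar_comp M N (g : N -> k) (f : M -> N) :
  scalar g -> is_linear f -> scalar (fun x => g (f x)).
Proof. by move=> lg lf a x y; rewrite lf lg. Qed.

Lemma scalar_mull M (f : M -> k) c : scalar f -> scalar (fun x => f x * c).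
Proof. by move=> lf a x y; rewrite lf mulrDl mulrA. Qed.

Lemma scalar_mulr M (f : M -> k) c : scalar f -> scalar (fun x => c * f x).
Proof. by move=> lf a x y; rewrite lf mulrDr mulrCA. Qed.

Lemma eq_linear_tensor M N W (f g : M ⊗ N -> W) :
  is_linear f -> is_linear g ->
  (forall x y, f (x ⊗ y) = g (x ⊗ y)) -> forall t, f t = g t.
Proof.
move=> lf lg fg t; rewrite (tensor_span t).
rewrite -[X in f X]/(tensor_sum tens t) -[X in g X]/(tensor_sum tens t).
by rewrite !linear_tensor_sum //; apply: eq_tensor_sum.
Qed.

Lemma is_linear_tensor_sum M N W (F : M -> N -> W) :
  is_bilinear F -> is_linear (tensor_sum F).
Proof. exact: tensor_sum_linear. Qed.

Lemma bilinear_intro M N W (F : M -> N -> W) :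
  (forall y, is_linear (fun x => F x y)) -> (forall x, is_linear (F x)) ->
  is_bilinear F.
Proof. by []. Qed.

Lemma linear_right M N W (F : M -> N -> W) x :
  is_bilinear F -> is_linear (F x).
Proof. by case=> _ /(_ x). Qed.

Lemma trilinear1 M N P W (F : M -> N -> P -> W) y z :
  is_trilinear F -> is_linear (fun x => F x y z).
Proof. by case. Qed.

Lemma trilinear2 M N P W (F : M -> N -> P -> W) x z :
  is_trilinear F -> is_linear (fun y => F x y z).
Proof. by case. Qed.

Lemma trilinear3 M N P W (F : M -> N -> P -> W) x y :
  is_trilinear F -> is_linear (F x y).
Proof. by case. Qed.

End Linear.

(* Automatic proofs of multilinearity *)
Create HintDb linear_db.
#[export] Hint Resolve tens_bilinear trilinear1 trilinear2 trilinear3 : linear_db.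

(** The leaves of the recursion in [lin]. [nocore] keeps [eauto] from calling [lin] back through the
    core hints registered below. *)
Ltac linear_atom :=
  solve [ assumption
        | match goal with
          | F : forall _, is_linear _ |- _ => simple apply F
          | F : forall _ _, is_linear _ |- _ => simple apply F
          | F : forall _ _ _, is_linear _ |- _ => simple apply F
          | F : forall _, is_bilinear _ |- _ => simple apply F
          | F : forall _, is_trilinear _ |- _ => simple apply F
          end
        | eauto 4 with linear_db nocore ].
(** Recursion on the syntax of the body: the variable sits in the tensor summed over, in the
    summand, or in one argument of an operation known to be linear there. Registered as a core hint
    of cost 0, it lets a plain [//] discharge the multilinearity side conditions of all Sweedler
    rewrites. *)
Ltac lin :=
  cbv beta;
  match goal with
  | |- is_bilinear _ => first [linear_atom | apply: bilinear_intro; intro; lin]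
  | |- is_trilinear _ => first [linear_atom | split; intros; lin]
  | |- is_linear (fun x => x) => apply: linear_id
  | |- is_linear (tensor_sum ?F) => apply: (@is_linear_tensor_sum _ _ _ _ F); lin
  | |- is_linear (fun x => tensor_sum ?F (@?t x)) =>
      apply: (@linear_sum_tensor _ _ _ _ _ F t); lin
  | |- is_linear (fun x => tensor_sum (@?F x) ?t) =>
      apply: (@linear_sum_body _ _ _ _ _ F t); intros; lin
  | |- is_linear (fun x => ?c *: (@?f x)) =>
      apply: (@linear_scaler _ _ _ f c); lin
  | |- is_linear (fun x => (@?f x) *: ?v) =>
      apply: (@linear_scalel _ _ _ f v); lin_scalar
  | |- is_linear (fun x => ?op (@?f x) ?z) =>
      apply: (@linear_binl _ _ _ _ _ op f z); [linear_atom|lin]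
  | |- is_linear (fun x => ?op ?z (@?f x)) =>
      apply: (@linear_binr _ _ _ _ _ op f z); [linear_atom|lin]
  | |- is_linear (fun x => ?g (@?f x)) =>
      apply: (@linear_comp _ _ _ _ g f); [linear_atom|lin]
  | |- is_linear (fun x => ?g (@?f x) ?y ?z) =>
      apply: (@linear_comp _ _ _ _ (fun t => g t y z) f); [linear_atom|lin]
  | |- is_linear (fun x => ?g ?y (@?f x) ?z) =>
      apply: (@linear_comp _ _ _ _ (fun t => g y t z) f); [linear_atom|lin]
  | |- is_linear (fun x => ?g ?u (@?f x) ?y ?z) =>
      apply: (@linear_comp _ _ _ _ (fun t => g u t y z) f); [linear_atom|lin]
  | |- is_linear (fun x => ?g (@?f x) ?u ?y ?z) =>
      apply: (@linear_comp _ _ _ _ (fun t => g t u y z) f); [linear_atom|lin]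
  | |- is_linear (?op ?z) =>
      first [linear_atom | apply: (@linear_right _ _ _ _ op z); linear_atom]
  | |- _ => linear_atom
  end
with lin_scalar :=
  cbv beta;
  match goal with
  | |- linear_for _ (fun x => ?c * (@?f x)) =>
      apply: (@scalar_mulr _ _ f c); lin_scalar
  | |- linear_for _ (fun x => (@?f x) * ?c) =>
      apply: (@scalar_mull _ _ f c); lin_scalar
  | |- linear_for _ (fun x => ?g (@?f x)) =>
      apply: (@scalar_comp _ _ _ g f); [linear_atom|lin]
  | |- _ => linear_atom
  end.
#[export] Hint Extern 0 (is_bilinear _) => lin : core.
#[export] Hint Extern 0 (is_trilinear _) => lin : core.
#[export] Hint Extern 0 (is_linear _) => lin : core.

(** * The underlying ordinary Hopf algebra *)

Definition smul (k : fieldType) (H : hom_ops k) (a b : H) : H :=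
  twistV (hmul a b).
Definition scomul (k : fieldType) (H : hom_ops k) (c : H) : (H ⊗ H)%type :=
  \sw_(x, y <- comul c) (twist x ⊗ twist y).

Local Notation "a ⊙ b" := (smul a b) (at level 38, left associativity).
Local Notation "'δ' c" := (scomul c) (at level 10, c at level 8).

Section Bialgebra.
Variables (k : fieldType) (H : hom_ops k).
Hypothesis hH : is_hom_bialgebra H.
Implicit Types (a b c h : H) (W V : lmodType k).

Lemma twistK : cancel (@twist k H) twistV.
Proof. by case: (alg_twist_aut (bialg_algebra hH)). Qed.

Lemma twistVK : cancel (@twistV k H) twist.
Proof. by case: (alg_twist_aut (bialg_algebra hH)). Qed.

Lemma twist_linear : is_linear (@twist k H).
Proof. by case: (alg_twist_aut (bialg_algebra hH)). Qed.

Lemma twistV_linear : is_linear (@twistV k H).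
Proof.
by move=> a x y; apply: (can_inj twistK); rewrite twist_linear !twistVK.
Qed.

Lemma hmul_bilinear : is_bilinear (@hmul k H).
Proof. exact: mul_bilinear (bialg_algebra hH). Qed.

Lemma comul_is_linear : is_linear (@comul k H).
Proof. exact: comul_linear (bialg_coalgebra hH). Qed.

Lemma counit_scalar : scalar (@counit k H).
Proof. exact: counit_linear (bialg_coalgebra hH). Qed.

Hint Resolve twist_linear twistV_linear hmul_bilinear comul_is_linear
  counit_scalar : linear_db.

Lemma smul_bilinear : is_bilinear (@smul k H).
Proof. by rewrite /smul. Qed.

Lemma scomul_linear : is_linear (@scomul k H).
Proof. by rewrite /scomul. Qed.

Hint Resolve smul_bilinear scomul_linear : linear_db.

Lemma hmulE a b : hmul a b = twist (a ⊙ b).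
Proof. by rewrite /smul twistVK. Qed.

Lemma twistV_mul a b : twistV (hmul a b) = hmul (twistV a) (twistV b).
Proof.
by apply: (can_inj twistK); rewrite (twist_mul (bialg_algebra hH)) !twistVK.
Qed.

Lemma twist_smul a b : twist (a ⊙ b) = twist a ⊙ twist b.
Proof. by rewrite /smul -(twist_mul (bialg_algebra hH)) twistK twistVK. Qed.

Lemma twistV_smul a b : twistV (a ⊙ b) = twistV a ⊙ twistV b.
Proof. by rewrite /smul -twistV_mul. Qed.

Lemma twistV_unit : twistV (hunit H) = hunit H.
Proof. by rewrite -{1}(twist_unit (bialg_algebra hH)) twistK. Qed.

Lemma smulA a b c : a ⊙ (b ⊙ c) = a ⊙ b ⊙ c.
Proof.
apply: (can_inj twistK); apply: (can_inj twistK).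
by have := mul_hom_assoc (bialg_algebra hH) a b c; rewrite !hmulE -!twist_smul.
Qed.

Lemma smulu a : a ⊙ hunit H = a.
Proof. by rewrite /smul (mul_unitr (bialg_algebra hH)) twistK. Qed.

Lemma smulul a : hunit H ⊙ a = a.
Proof. by rewrite /smul (mul_unitl (bialg_algebra hH)) twistK. Qed.

(** Here and below, Sweedler identities are stated under an arbitrary multilinear [F], the universal
    property of the tensor product, so that they rewrite inside any larger expression. *)
Lemma sum_scomul W (F : H -> H -> W) c : is_bilinear F ->
  \sw_(x, y <- δ c) F x y = \sw_(x, y <- comul c) F (twist x) (twist y).
Proof.
move=> bF; rewrite /scomul linear_tensor_sum //.
by apply: eq_tensor_sum => x y; rewrite tensor_sum_tens.
Qed.

Lemma sum_comul W (F : H -> H -> W) c : is_bilinear F ->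
  \sw_(x, y <- comul c) F x y = \sw_(x, y <- δ c) F (twistV x) (twistV y).
Proof.
move=> bF; rewrite sum_scomul //.
by apply: eq_tensor_sum => x y; rewrite !twistK.
Qed.

Lemma sum_scomul_twist W (F : H -> H -> W) c : is_bilinear F ->
  \sw_(x, y <- δ (twist c)) F x y = \sw_(x, y <- δ c) F (twist x) (twist y).
Proof.
move=> bF; rewrite !sum_scomul // (comul_twist (bialg_coalgebra hH)).
rewrite linear_tensor_sum //.
by apply: eq_tensor_sum => x y; rewrite tensor_sum_tens.
Qed.

Lemma sum_scomul_twistV W (F : H -> H -> W) c : is_bilinear F ->
  \sw_(x, y <- δ (twistV c)) F x y = \sw_(x, y <- δ c) F (twistV x) (twistV y).
Proof.
move=> bF; rewrite -{2}[c]twistVK sum_scomul_twist //.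
by apply: eq_tensor_sum => x y; rewrite !twistK.
Qed.

Lemma sum_scomul_mul W (F : H -> H -> W) a b : is_bilinear F ->
  \sw_(x, y <- δ (a ⊙ b)) F x y =
  \sw_(a1, a2 <- δ a) \sw_(b1, b2 <- δ b) F (a1 ⊙ b1) (a2 ⊙ b2).
Proof.
move=> bF; rewrite /smul sum_scomul_twistV // !sum_scomul //.
rewrite (comul_mul hH) linear_tensor_sum //.
apply: eq_tensor_sum => x y; rewrite linear_tensor_sum // sum_scomul //.
apply: eq_tensor_sum => z w; rewrite tensor_sum_tens //.
by rewrite !(twist_mul (bialg_algebra hH)).
Qed.

Lemma sum_scomul_unit W (F : H -> H -> W) : is_bilinear F ->
  \sw_(x, y <- δ (hunit H)) F x y = F (hunit H) (hunit H).
Proof.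
move=> bF; rewrite sum_scomul // (comul_unit hH) tensor_sum_tens //.
by rewrite !(twist_unit (bialg_algebra hH)).
Qed.

Lemma counit_twistV c : counit (twistV c) = counit c.
Proof. by rewrite -{2}[c]twistVK (counit_twist (bialg_coalgebra hH)). Qed.

Lemma counit_smul a b : counit (a ⊙ b) = counit a * counit b.
Proof. by rewrite /smul counit_twistV (counit_mul hH). Qed.

Lemma sum_scomul_counitl W (F : H -> W) c : is_linear F ->
  \sw_(x, y <- δ c) (counit x *: F y) = F c.
Proof.
move=> lF; rewrite sum_scomul //.
rewrite -{2}[c]twistVK -(comul_counitl (bialg_coalgebra hH)).
rewrite (linear_tensor_sum _ _ twist_linear) linear_tensor_sum //.
apply: eq_tensor_sum => x y; rewrite (counit_twist (bialg_coalgebra hH)).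
by rewrite (linear_scale twist_linear) (linear_scale lF).
Qed.

Lemma sum_scomul_counitr W (F : H -> W) c : is_linear F ->
  \sw_(x, y <- δ c) (counit y *: F x) = F c.
Proof.
move=> lF; rewrite sum_scomul //.
rewrite -{2}[c]twistVK -(comul_counitr (bialg_coalgebra hH)).
rewrite (linear_tensor_sum _ _ twist_linear) linear_tensor_sum //.
apply: eq_tensor_sum => x y; rewrite (counit_twist (bialg_coalgebra hH)).
by rewrite (linear_scale twist_linear) (linear_scale lF).
Qed.

Lemma sum_comul_hom_coassoc W (F : H -> H -> H -> W) c : is_trilinear F ->
  \sw_(x, y <- comul c) \sw_(z, w <- comul y) F (twistV x) z w =
  \sw_(x, y <- comul c) \sw_(z, w <- comul x) F z w (twistV y).
Proof.
(* [L] is the linear map induced by [F] on triple tensors; applying it to the axiom, an equation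
   between tensors, gives the claim. *)
move=> tF; pose L (t : (H ⊗ (H ⊗ H))%type) := \sw_(x, t' <- t) \sw_(y, z <- t') F x y z.
have lL : is_linear L by rewrite /L.
have LE x y z : L (x ⊗ (y ⊗ z)) = F x y z by rewrite /L !tensor_sum_tens.
have := congr1 L (comul_hom_coassoc (bialg_coalgebra hH) c).
rewrite !linear_tensor_sum //.
under eq_tensor_sum do (rewrite linear_tensor_sum //; under eq_tensor_sum do rewrite LE).
move=> ->.
by apply: eq_tensor_sum => x y; rewrite linear_tensor_sum //; apply: eq_tensor_sum => z w; rewrite LE.
Qed.

(** Iterating [δ] puts [twist] twice on the two inner legs and once on the outer one.
    Hom-coassociativity, used for [F] precomposed with two twists in each argument, has a [twistV]
    on the outer leg that accounts for exactly this defect. *)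
Lemma sum_scomul_coassoc W (F : H -> H -> H -> W) c : is_trilinear F ->
  \sw_(x, y <- δ c) \sw_(z, w <- δ x) F z w y =
  \sw_(x, y <- δ c) \sw_(z, w <- δ y) F x z w.
Proof.
move=> tF; rewrite !sum_scomul //.
under eq_tensor_sum do (rewrite sum_scomul_twist // sum_scomul //).
under [RHS]eq_tensor_sum do (rewrite sum_scomul_twist // sum_scomul //).
have := @sum_comul_hom_coassoc _ (fun x y z => F (twist (twist x)) (twist (twist y)) (twist (twist z))) c.
rewrite /=; under eq_tensor_sum do under eq_tensor_sum do rewrite twistVK.
by under [in RHS]eq_tensor_sum do under eq_tensor_sum do rewrite twistVK; move<-.
Qed.

(** The middle legs [y] and [z] come from different halves on the left and from one coproduct on the
    right, which is where an antipode law can contract them. *)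
Lemma sum_scomul_coassoc4 W (F : H -> H -> H -> H -> W) c :
  (forall w, is_trilinear (fun x y z => F x y z w)) ->
  (forall x y z, is_linear (F x y z)) ->
  \sw_(s, t <- δ c) \sw_(x, y <- δ s) \sw_(z, w <- δ t) F x y z w =
  \sw_(x, s <- δ c) \sw_(t, w <- δ s) \sw_(y, z <- δ t) F x y z w.
Proof.
move=> F3 Fw; have F1 y z w : is_linear (fun x => F x y z w) by case: (F3 w).
have F2 x z w : is_linear (fun y => F x y z w) by case: (F3 w).
have F3' x y w : is_linear (fun z => F x y z w) by case: (F3 w).
rewrite (@sum_scomul_coassoc _ (fun x y t => \sw_(z, w <- δ t) F x y z w)) //.
apply: eq_tensor_sum => x s.
by rewrite sum_scomul_coassoc.
Qed.

End Bialgebra.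

#[export] Hint Resolve twist_linear twistV_linear hmul_bilinear comul_is_linear
  counit_scalar smul_bilinear scomul_linear : linear_db.

(** * Antipode laws for [⊙] and [δ], and how [S] reverses products and coproducts *)

Section Antipode.
Variables (k : fieldType) (H : hom_ops k) (S : H -> H).
Hypotheses (hH : is_hom_bialgebra H) (hS : is_antipode H S).
Implicit Types (a b c h : H) (W V : lmodType k).

Lemma antipode_is_linear : is_linear S.
Proof. exact: antipode_linear hS. Qed.

Hint Resolve antipode_is_linear : linear_db.

Lemma antipode_twistV a : S (twistV a) = twistV (S a).
Proof.
by apply: (can_inj (twistK hH)); rewrite -(antipode_twist hS) !(twistVK hH).
Qed.

Lemma sum_antipodel W (F : H -> W) c : is_linear F ->
  \sw_(x, y <- δ c) F (S x ⊙ y) = counit c *: F (hunit H).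
Proof.
move=> lF; rewrite sum_scomul // -(linear_scale lF).
rewrite -(antipode_mull hS) linear_tensor_sum //.
apply: eq_tensor_sum => x y; rewrite (antipode_twist hS).
by rewrite -(twist_smul hH) -(hmulE hH).
Qed.

Lemma sum_antipoder W (F : H -> W) c : is_linear F ->
  \sw_(x, y <- δ c) F (x ⊙ S y) = counit c *: F (hunit H).
Proof.
move=> lF; rewrite sum_scomul // -(linear_scale lF).
rewrite -(antipode_mulr hS) linear_tensor_sum //.
apply: eq_tensor_sum => x y; rewrite (antipode_twist hS).
by rewrite -(twist_smul hH) -(hmulE hH).
Qed.

Lemma antipode_unit : S (hunit H) = hunit H.
Proof.
have := @sum_antipodel H id (hunit H) (@linear_id _ _).
by rewrite (sum_scomul_unit hH) // (smulu hH) (counit_unit hH) scale1r.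
Qed.

(** Apply the counit to S(a1) a2 = ε(a) 1 and contract a2. Scalars are viewed in [k^o] so that the
    vector-valued lemmas apply. *)
Lemma counit_antipode a : counit (S a) = counit a.
Proof.
have := @sum_antipodel k^o (@counit k H) a (counit_scalar hH).
rewrite (counit_unit hH) /GRing.scale /= mulr1 => <-.
rewrite -(@sum_scomul_counitr _ _ hH k^o (fun x => counit (S x))) //; last first.
  exact: scalar_comp (counit_scalar hH) antipode_is_linear.
by apply: (@eq_tensor_sum _ _ _ k^o) => x y; rewrite (counit_smul hH) mulrC.
Qed.

(** Uniqueness of convolution inverses: both sides invert (a, b) |-> ab, and S(a1 b1) (a2 b2) (S(b3)
    S(a3)) is evaluated with its two bracketings. *)
Lemma antipode_mul a b : S (a ⊙ b) = S b ⊙ S a.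
Proof.
transitivity (\sw_(a1, a2 <- δ a) \sw_(b1, b2 <- δ b)
   \sw_(x, y <- δ (a1 ⊙ b1)) (S x ⊙ y ⊙ (S b2 ⊙ S a2))); last first.
  under eq_tensor_sum => a1 a2 do under eq_tensor_sum => b1 b2 do
    rewrite (@sum_antipodel _ (fun x => x ⊙ (S b2 ⊙ S a2))) //
      (counit_smul hH) (smulul hH) -scalerA.
  under eq_tensor_sum => a1 a2 do
    rewrite tensor_sum_scaler (@sum_scomul_counitl _ _ hH _ (fun x => S x ⊙ S a2)) //.
  by rewrite (sum_scomul_counitl hH).
symmetry.
under eq_tensor_sum => a1 a2 do under eq_tensor_sum => b1 b2 do
  rewrite (sum_scomul_mul hH) //.
under eq_tensor_sum => a1 a2 do rewrite exchange_tensor_sum.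
rewrite (sum_scomul_coassoc hH) //.
under eq_tensor_sum => a1 a2 do under eq_tensor_sum => a3 a4 do
  rewrite (sum_scomul_coassoc hH) //.
(* The product of a leg of [b] with the antipode of the next is enclosed between [a3] and [S a4], so
   it has to collapse first. *)
transitivity (\sw_(a1, a2 <- δ a) \sw_(a3, a4 <- δ a2)
   \sw_(b1, b2 <- δ b) (counit b2 *: (S (a1 ⊙ b1) ⊙ (a3 ⊙ S a4)))).
  apply: eq_tensor_sum => a1 a2; apply: eq_tensor_sum => a3 a4.
  apply: eq_tensor_sum => b1 b2.
  transitivity (\sw_(z, w <- δ b2) (S (a1 ⊙ b1) ⊙ (a3 ⊙ (z ⊙ S w) ⊙ S a4))).
    by apply: eq_tensor_sum => b3 b4; rewrite !(smulA hH).
  by rewrite (@sum_antipoder _ (fun x => S (a1 ⊙ b1) ⊙ (a3 ⊙ x ⊙ S a4))) // (smulu hH).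
under eq_tensor_sum => a1 a2 do under eq_tensor_sum => a3 a4 do
  rewrite (@sum_scomul_counitr _ _ hH _ (fun x => S (a1 ⊙ x) ⊙ (a3 ⊙ S a4))) //.
under eq_tensor_sum => a1 a2 do
  rewrite (@sum_antipoder _ (fun x => S (a1 ⊙ b) ⊙ x)) // (smulu hH).
by rewrite (@sum_scomul_counitr _ _ hH _ (fun x => S (x ⊙ b))).
Qed.

(** The dual convolution argument: δ(S(c1) c2) multiplied by S(c4) ⊗ S(c3), contracted either at c1,
    c2 or, after splitting the first factor, at the remaining legs. *)
Lemma sum_scomul_antipode W (F : H -> H -> W) c : is_bilinear F ->
  \sw_(x, y <- δ (S c)) F x y = \sw_(x, y <- δ c) F (S y) (S x).
Proof.
move=> bF.
transitivity (\sw_(s, t <- δ c) \sw_(u, v <- δ s)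
  \sw_(p, q <- δ (S u ⊙ v)) \sw_(x, y <- δ t) F (p ⊙ S y) (q ⊙ S x)); last first.
  under eq_tensor_sum => s t.
    rewrite (@sum_antipodel _ (fun z => \sw_(p, q <- δ z)
      \sw_(x, y <- δ t) F (p ⊙ S y) (q ⊙ S x))) // (sum_scomul_unit hH) //.
    under eq_tensor_sum do rewrite !(smulul hH).
    over.
  by rewrite (@sum_scomul_counitl _ _ hH _ (fun t => \sw_(x, y <- δ t) F (S y) (S x))).
symmetry; under eq_tensor_sum => s t do under eq_tensor_sum => u v do
  rewrite (sum_scomul_mul hH) //.
rewrite (sum_scomul_coassoc hH) //.
(* This is t1 S(t4) ⊗ t2 S(t3) = ε(t) 1 ⊗ 1, multiplied on the left by [p] and [q]: t2 S(t3) is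
   contracted first, which makes t1 and S(t4) adjacent. *)
have key p q t : \sw_(s, w <- δ t) \sw_(u, v <- δ s) \sw_(x, y <- δ w)
    F (p ⊙ u ⊙ S y) (q ⊙ v ⊙ S x) = counit t *: F p q.
  rewrite (sum_scomul_coassoc4 hH) //.
  transitivity (\sw_(x, y <- δ t) F (p ⊙ (x ⊙ S y)) q); last first.
    by rewrite (@sum_antipoder _ (fun x => F (p ⊙ x) q)) // (smulu hH).
  apply: eq_tensor_sum => x s.
  transitivity (\sw_(z, w <- δ s) \sw_(y, y' <- δ z) F (p ⊙ x ⊙ S w) (q ⊙ (y ⊙ S y'))).
    by apply: eq_tensor_sum => z w; apply: eq_tensor_sum => y y'; rewrite !(smulA hH).
  under eq_tensor_sum => z w do
    rewrite (@sum_antipoder _ (fun y => F (p ⊙ x ⊙ S w) (q ⊙ y))) // (smulu hH).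
  by rewrite (@sum_scomul_counitl _ _ hH _ (fun w => F (p ⊙ x ⊙ S w) q)) // (smulA hH).
transitivity (\sw_(x, y <- δ c) (counit y *: \sw_(p, q <- δ (S x)) F p q)).
  apply: eq_tensor_sum => x y.
  under eq_tensor_sum => z w do rewrite exchange_tensor_sum.
  under eq_tensor_sum => z w. rewrite exchange_tensor_sum. over.
  rewrite exchange_tensor_sum -tensor_sum_scaler.
  apply: eq_tensor_sum => p q; rewrite -key.
  by apply: eq_tensor_sum => z w; rewrite exchange_tensor_sum.
by rewrite (@sum_scomul_counitr _ _ hH _ (fun x => \sw_(p, q <- δ (S x)) F p q)).
Qed.

End Antipode.

(** * Adjoint action and coadjoint coaction *)

Section Adjoint.
Variables (k : fieldType) (H : hom_ops k) (S : H -> H).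
Hypotheses (hH : is_hom_bialgebra H) (hS : is_antipode H S).
Implicit Types (a b c h g t : H) (W V : lmodType k).

Hint Resolve antipode_is_linear : linear_db.

(** The ordinary right adjoint action S(h1) a h2 and, in [sco], the ordinary coadjoint coaction h2 ⊗
    S(h1) h3. The Hom-versions differ only by a [twist] on the result and by a [twistV] on both
    legs, respectively. *)
Definition sad h a : H := \sw_(x, y <- δ h) (S x ⊙ a ⊙ y).
Definition sco h : (H ⊗ H)%type :=
  \sw_(s, z <- δ h) \sw_(x, y <- δ s) (y ⊗ (S x ⊙ z)).

Lemma sad_bilinear : is_bilinear sad.
Proof. by rewrite /sad. Qed.

Lemma sco_linear : is_linear sco.
Proof. by rewrite /sco. Qed.

Hint Resolve sad_bilinear sco_linear : linear_db.

Lemma sum_sco W (F : H -> H -> W) h : is_bilinear F ->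
  \sw_(p, q <- sco h) F p q =
  \sw_(s, z <- δ h) \sw_(x, y <- δ s) F y (S x ⊙ z).
Proof.
move=> bF; rewrite /sco linear_tensor_sum //.
apply: eq_tensor_sum => s z; rewrite linear_tensor_sum //.
by apply: eq_tensor_sum => x y; rewrite tensor_sum_tens.
Qed.

Lemma twist_sad h a : twist (sad h a) = sad (twist h) (twist a).
Proof.
rewrite /sad linear_tensor_sum // (sum_scomul_twist hH) //.
by apply: eq_tensor_sum => x y; rewrite !(twist_smul hH) (antipode_twist hS).
Qed.

Lemma sum_sco_twistV W (F : H -> H -> W) h : is_bilinear F ->
  \sw_(p, q <- sco (twistV h)) F p q =
  \sw_(p, q <- sco h) F (twistV p) (twistV q).
Proof.
move=> bF; rewrite !sum_sco // (sum_scomul_twistV hH) //.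
apply: eq_tensor_sum => s z; rewrite (sum_scomul_twistV hH) //.
apply: eq_tensor_sum => x y.
by rewrite (twistV_smul hH) (antipode_twistV hH hS).
Qed.

Lemma sum_sco_twist W (F : H -> H -> W) h : is_bilinear F ->
  \sw_(p, q <- sco (twist h)) F p q =
  \sw_(p, q <- sco h) F (twist p) (twist q).
Proof.
move=> bF; rewrite -{2}[h](twistK hH) sum_sco_twistV //.
by apply: eq_tensor_sum => p q; rewrite !(twistVK hH).
Qed.

Lemma adj_actE h a : adj_act S h a = twist (sad h a).
Proof.
rewrite /adj_act /sad linear_tensor_sum // (sum_comul hH) //.
apply: eq_tensor_sum => x y; rewrite !(hmulE hH) (antipode_twistV hH hS).
by rewrite !(twist_smul hH) !(twistVK hH).
Qed.

Lemma sum_adj_coact W (F : H -> H -> W) h : is_bilinear F ->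
  \sw_(p, q <- adj_coact S h) F p q =
  \sw_(p, q <- sco h) F (twistV p) (twistV q).
Proof.
move=> bF.
rewrite -[adj_coact S h]/(\sw_(s, z <- comul h) \sw_(x, y <- comul s)
  (twist y ⊗ hmul (S x) (twistV z)) : (H ⊗ H)%type).
rewrite linear_tensor_sum // sum_sco // (sum_comul hH) //.
apply: eq_tensor_sum => s z; rewrite linear_tensor_sum //.
rewrite (sum_comul hH) // (sum_scomul_twistV hH) //.
apply: eq_tensor_sum => x y; rewrite tensor_sum_tens //.
rewrite (hmulE hH) !(antipode_twistV hH hS) !(twist_smul hH) !(twistVK hH).
by rewrite (twistV_smul hH).
Qed.

(** [S] reverses products; the order [g ⊙ h] is the product of [h] and [g] in [hop H], hence a left
    action of the opposite algebra. *)
Lemma sad_mul h g a : sad h (sad g a) = sad (g ⊙ h) a.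
Proof.
rewrite /sad (sum_scomul_mul hH) // exchange_tensor_sum.
apply: eq_tensor_sum => x y.
rewrite (linear_tensor_sum (L := fun z => S x ⊙ z ⊙ y)) //.
apply: eq_tensor_sum => z w.
by rewrite (antipode_mul hH hS) !(smulA hH).
Qed.

Lemma sad_unitl a : sad (hunit H) a = a.
Proof.
by rewrite /sad (sum_scomul_unit hH) // (antipode_unit hH hS) (smulul hH) (smulu hH).
Qed.

Lemma sad_unitr h : sad h (hunit H) = counit h *: hunit H.
Proof.
rewrite -(@sum_antipodel _ _ _ hH hS _ id) //.
by apply: eq_tensor_sum => x y; rewrite (smulu hH).
Qed.

(** Innerness of the action: in t1 S(t2) b t3 the first two factors cancel. *)
Lemma sum_smul_sad b t : \sw_(x, y <- δ t) (x ⊙ sad y b) = b ⊙ t.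
Proof.
transitivity (\sw_(s, w <- δ t) \sw_(x, y <- δ s) (x ⊙ S y ⊙ (b ⊙ w))).
  rewrite (sum_scomul_coassoc hH) //.
  apply: eq_tensor_sum => x y; rewrite /sad linear_tensor_sum //.
  by apply: eq_tensor_sum => z w; rewrite !(smulA hH).
under eq_tensor_sum => s w do
  rewrite (@sum_antipoder _ _ _ hH hS _ (fun x => x ⊙ (b ⊙ w))) // (smulul hH).
by rewrite (sum_scomul_counitl hH).
Qed.

(** Both sides equal S(h1) a h2 sad(h3, b): the first three factors form sad(h1, a), while by
    innerness the last two form b h2. *)
Lemma sad_smul h a b :
  sad h (a ⊙ b) = \sw_(x, y <- δ h) (sad x a ⊙ sad y b).
Proof.
transitivity (\sw_(s, t <- δ h) \sw_(x, y <- δ s) (S x ⊙ a ⊙ (y ⊙ sad t b))).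
  rewrite (sum_scomul_coassoc hH) //.
  apply: eq_tensor_sum => x y.
  rewrite -(linear_tensor_sum (L := fun z => S x ⊙ a ⊙ z)) // sum_smul_sad.
  by rewrite !(smulA hH).
apply: eq_tensor_sum => x y; rewrite {2}/sad.
rewrite (linear_tensor_sum (L := fun z => z ⊙ sad y b)) //.
by apply: eq_tensor_sum => z w; rewrite !(smulA hH).
Qed.

(** Dual of innerness: in t3 ⊗ t1 S(t2) t4 the factor t1 S(t2) cancels. *)
Lemma sum_smul_sco W (F : H -> H -> W) t : is_bilinear F ->
  \sw_(x, y <- δ t) \sw_(p, q <- sco y) F p (x ⊙ q) = \sw_(x, y <- δ t) F x y.
Proof.
move=> bF; under eq_tensor_sum => x y do rewrite sum_sco //.
transitivity (\sw_(x, s <- δ t) \sw_(u, z <- δ s) \sw_(w, v <- δ u)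
    F v (x ⊙ S w ⊙ z)).
  apply: eq_tensor_sum => x s; apply: eq_tensor_sum => u z.
  by apply: eq_tensor_sum => w v; rewrite (smulA hH).
rewrite -(@sum_scomul_coassoc4 _ _ hH _ (fun x w v z => F v (x ⊙ S w ⊙ z))) //.
under eq_tensor_sum => u v.
  rewrite exchange_tensor_sum.
  under eq_tensor_sum => z w do
    rewrite (@sum_antipoder _ _ _ hH hS _ (fun x => F z (x ⊙ w))) // (smulul hH).
  rewrite tensor_sum_scaler; over.
by rewrite (@sum_scomul_counitl _ _ hH _ (fun v => \sw_(z, w <- δ v) F z w)).
Qed.

Lemma sum_sco_comul W (F : H -> H -> H -> W) h : is_trilinear F ->
  \sw_(p, q <- sco h) \sw_(x, y <- δ q) F p x y =
  \sw_(p, q <- sco h) \sw_(x, y <- sco p) F x y q.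
Proof.
move=> tF; rewrite !sum_sco //.
(* The common value is h3 ⊗ S(h2) h4 ⊗ S(h1) h5; on the left it relies on [S] reversing the
   coproduct. *)
transitivity (\sw_(s, z <- δ h) \sw_(p, r <- δ s) \sw_(x, y <- δ p)
   \sw_(u, v <- δ x) F y (S v ⊙ r) (S u ⊙ z)).
  rewrite (@sum_scomul_coassoc _ _ hH _ (fun p r z => \sw_(x, y <- δ p)
   \sw_(u, v <- δ x) F y (S v ⊙ r) (S u ⊙ z))) //.
  apply: eq_tensor_sum => s z; rewrite [RHS]exchange_tensor_sum.
  apply: eq_tensor_sum => x y; rewrite (sum_scomul_mul hH) //.
  rewrite (sum_scomul_antipode hH hS) //.
  by rewrite exchange_tensor_sum.
apply: eq_tensor_sum => s z.
under [RHS]eq_tensor_sum => x y do rewrite sum_sco //.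
under [LHS]eq_tensor_sum => p r do rewrite (sum_scomul_coassoc hH) //.
by rewrite (@sum_scomul_coassoc _ _ hH _ (fun u y r => \sw_(v, w <- δ y) F w (S v ⊙ r) (S u ⊙ z))).
Qed.

Lemma sum_sco_counit W (F : H -> W) h : is_linear F ->
  \sw_(p, q <- sco h) (counit q *: F p) = F h.
Proof.
move=> lF; rewrite sum_sco //.
under eq_tensor_sum => s z do under eq_tensor_sum => x y do
  rewrite (counit_smul hH) (counit_antipode hH hS) mulrC -scalerA.
under eq_tensor_sum => s z do
  rewrite tensor_sum_scaler (sum_scomul_counitl hH) //.
by rewrite (sum_scomul_counitr hH).
Qed.

Lemma sum_counit_sco W (F : H -> W) h : is_linear F ->
  \sw_(p, q <- sco h) (counit p *: F q) = counit h *: F (hunit H).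
Proof.
move=> lF; rewrite sum_sco //.
under eq_tensor_sum => s z do
  rewrite (@sum_scomul_counitr _ _ hH _ (fun x => F (S x ⊙ z))) //.
by rewrite (sum_antipodel hH hS).
Qed.

Lemma sum_scomul_sco W (F : H -> H -> H -> W) h : is_trilinear F ->
  \sw_(p, q <- sco h) \sw_(x, y <- δ p) F x y q =
  \sw_(s, t <- δ h) \sw_(p, q <- sco s) \sw_(p', q' <- sco t) F p p' (q ⊙ q').
Proof.
move=> tF; rewrite sum_sco //.
transitivity (\sw_(s, t <- δ h) \sw_(x, y <- δ s) \sw_(z, w <- δ t)
   F y z (S x ⊙ w)).
  by rewrite (sum_scomul_coassoc4 hH) // (sum_scomul_coassoc hH).
(* Backward use of [sum_smul_sco] on the pair [z], [w]. The new factor [z] completes [S x] to the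
   coaction of the first half of [h], and [q] belongs to the coaction of the second half. *)
transitivity (\sw_(s, t <- δ h) \sw_(x, y <- δ s) \sw_(z, w <- δ t)
   \sw_(p, q <- sco w) F y p (S x ⊙ (z ⊙ q))).
  apply: eq_tensor_sum => s t; apply: eq_tensor_sum => x y.
  by rewrite (@sum_smul_sco _ (fun p q => F y p (S x ⊙ q))).
under eq_tensor_sum => s t do rewrite exchange_tensor_sum.
rewrite -(@sum_scomul_coassoc _ _ hH _ (fun s z w => \sw_(x, y <- δ s)
   \sw_(p, q <- sco w) F y p (S x ⊙ (z ⊙ q)))) //.
apply: eq_tensor_sum => s w; rewrite sum_sco //.
apply: eq_tensor_sum => u z; apply: eq_tensor_sum => x y.
by apply: eq_tensor_sum => p q; rewrite (smulA hH).
Qed.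

End Adjoint.

(** * Opposite, tensor product and transport of bialgebras *)

Lemma hop_bialgebra (k : fieldType) (H : hom_ops k) :
  is_hom_bialgebra H -> is_hom_bialgebra (hop H).
Proof.
case=> [[aut bm mA m1 l1 tm tu] coalg cm cu em eu].
split=> [||a b|//|a b|//].
- split=> //; first by case: bm => bl br; split=> y; [apply: br|apply: bl].
  + by move=> a b c; rewrite /= mA.
  + by move=> a b; rewrite /= tm.
- by case: coalg => *; split.
- by rewrite /= cm exchange_tensor_sum.
- by rewrite /= em mulrC.
Qed.

(** The source of the transport. Carrier, twist, unit and counit are written as in [bicross]; only
    product and coproduct differ. *)
Definition tensor_ops (k : fieldType) (B K : hom_ops k) : hom_ops k :=
  {| carrier := (B ⊗ K)%type : lmodType k;
     twist := fun x : B ⊗ K => \sw_(a, h <- x) (twist a ⊗ twist h);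
     twistV := fun x : B ⊗ K => \sw_(a, h <- x) (twistV a ⊗ twistV h);
     hmul := fun x y : B ⊗ K =>
       \sw_(a, h <- x) \sw_(b, g <- y) (hmul a b ⊗ hmul h g);
     hunit := hunit B ⊗ hunit K;
     comul := fun x : B ⊗ K =>
       \sw_(a, h <- x) \sw_(a1, a2 <- comul a) \sw_(h1, h2 <- comul h)
         ((a1 ⊗ h1) ⊗ (a2 ⊗ h2));
     counit :=
       tensor_sum (W := k^o) (fun (a : B) (h : K) => counit a * counit h) |}.

Section TensorBialgebra.
Variables (k : fieldType) (B K : hom_ops k).
Hypotheses (hB : is_hom_bialgebra B) (hK : is_hom_bialgebra K).
Local Notation T := (tensor_ops B K).

Lemma tensor_twist_linear : is_linear (@twist k T).
Proof. by rewrite /=. Qed.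

Lemma tensor_twistV_linear : is_linear (@twistV k T).
Proof. by rewrite /=. Qed.

Lemma tensor_mul_bilinear : is_bilinear (@hmul k T).
Proof. by rewrite /=. Qed.

Lemma tensor_comul_linear : is_linear (@comul k T).
Proof. by rewrite /=. Qed.

Lemma counit_mul_bilinear :
  @is_bilinear k B K k^o (fun a h => counit a * counit h).
Proof.
split=> y; [apply: scalar_mull|apply: scalar_mulr]; exact: counit_scalar.
Qed.

Lemma tensor_counit_scalar : scalar (@counit k T).
Proof. exact: tensor_sum_linear counit_mul_bilinear. Qed.

Hint Resolve tensor_twist_linear tensor_twistV_linear tensor_mul_bilinear
  tensor_comul_linear tensor_counit_scalar : linear_db.

Lemma tensor_twistE a h : @twist k T (a ⊗ h) = twist a ⊗ twist h.
Proof. by rewrite /= tensor_sum_tens. Qed.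

Lemma tensor_twistVE a h : @twistV k T (a ⊗ h) = twistV a ⊗ twistV h.
Proof. by rewrite /= tensor_sum_tens. Qed.

Lemma tensor_mulE a h b g :
  @hmul k T (a ⊗ h) (b ⊗ g) = hmul a b ⊗ hmul h g.
Proof. by rewrite /= !tensor_sum_tens. Qed.

Lemma tensor_counitE a h : @counit k T (a ⊗ h) = counit a * counit h.
Proof. by rewrite /= tensor_sum_tens //; apply: counit_mul_bilinear. Qed.

Lemma sum_tensor_comul (W : lmodType k) (F : T -> T -> W) a h : is_bilinear F ->
  \sw_(x, y <- @comul k T (a ⊗ h)) F x y =
  \sw_(a1, a2 <- comul a) \sw_(h1, h2 <- comul h) F (a1 ⊗ h1) (a2 ⊗ h2).
Proof.
move=> bF; rewrite /= tensor_sum_tens // linear_tensor_sum //.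
apply: eq_tensor_sum => a1 a2; rewrite linear_tensor_sum //.
by apply: eq_tensor_sum => h1 h2; rewrite tensor_sum_tens.
Qed.

Lemma tensor_algebra : is_hom_algebra T.
Proof.
split=> [||x y z|x|x|x y|].
- split; first exact: tensor_twist_linear.
    apply: (eq_linear_tensor (f := fun x => @twistV k T (@twist k T x)))
      => // a h.
    by rewrite tensor_twistE tensor_twistVE (twistK hB) (twistK hK).
  apply: (eq_linear_tensor (f := fun x => @twist k T (@twistV k T x)))
    => // a h.
  by rewrite tensor_twistVE tensor_twistE (twistVK hB) (twistVK hK).
- exact: tensor_mul_bilinear.
- move: x; apply: eq_linear_tensor => // a h.
  move: y; apply: eq_linear_tensor => // b g.
  move: z; apply: eq_linear_tensor => // c l.
  rewrite !tensor_twistE !tensor_mulE !(mul_hom_assoc (bialg_algebra _)) //.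
- move: x; apply: eq_linear_tensor => // a h.
  by rewrite tensor_mulE tensor_twistE !(mul_unitr (bialg_algebra _)).
- move: x; apply: eq_linear_tensor => // a h.
  by rewrite tensor_mulE tensor_twistE !(mul_unitl (bialg_algebra _)).
- move: x; apply: eq_linear_tensor => // a h.
  move: y; apply: eq_linear_tensor => // b g.
  by rewrite !tensor_twistE !tensor_mulE tensor_twistE !(twist_mul (bialg_algebra _)).
- by rewrite tensor_twistE !(twist_unit (bialg_algebra _)).
Qed.

Lemma tensor_coalgebra : is_hom_coalgebra T.
Proof.
split=> [||||x|x|x|x].
- exact: alg_twist_aut tensor_algebra.
- exact: tensor_comul_linear.
- exact: tensor_counit_scalar.
- apply: eq_linear_tensor => // a h; rewrite !sum_tensor_comul //.
  under [LHS]eq_tensor_sum => a1 a2 do under eq_tensor_sum => h1 h2 do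
    rewrite sum_tensor_comul // tensor_twistVE.
  under [RHS]eq_tensor_sum => a1 a2 do under eq_tensor_sum => h1 h2 do
    rewrite sum_tensor_comul // tensor_twistVE.
  under [LHS]eq_tensor_sum => a1 a2 do rewrite exchange_tensor_sum.
  under [RHS]eq_tensor_sum => a1 a2 do rewrite exchange_tensor_sum.
  (* Hom-coassociativity is used in [B] with the sums over [h] frozen inside the trilinear map, and
     then in [K]. *)
  rewrite (@sum_comul_hom_coassoc _ _ hB _ (fun x y z =>
    \sw_(h1, h2 <- comul h) \sw_(u, v <- comul h2)
      ((x ⊗ twistV h1) ⊗ ((y ⊗ u) ⊗ (z ⊗ v))))) //.
  apply: eq_tensor_sum => a1 a2; apply: eq_tensor_sum => a3 a4.
  by rewrite (@sum_comul_hom_coassoc _ _ hK _ (fun x y z =>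
      ((a3 ⊗ x) ⊗ ((a4 ⊗ y) ⊗ (twistV a2 ⊗ z))))).
- move: x; apply: eq_linear_tensor => // a h; rewrite sum_tensor_comul //.
  rewrite tensor_twistVE -(comul_counitr (bialg_coalgebra hB)).
  rewrite (linear_tensor_sum (L := fun x => x ⊗ _)) //.
  apply: eq_tensor_sum => a1 a2; rewrite -(comul_counitr (bialg_coalgebra hK)).
  rewrite linear_tensor_sum //.
  apply: eq_tensor_sum => h1 h2; rewrite tensor_counitE -scalerA.
  by rewrite (linear_scale (f := fun x => x ⊗ _)) // (linear_scale (f := tens a1)).
- move: x; apply: eq_linear_tensor => // a h; rewrite sum_tensor_comul //.
  rewrite tensor_twistVE -(comul_counitl (bialg_coalgebra hB)).
  rewrite (linear_tensor_sum (L := fun x => x ⊗ _)) //.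
  apply: eq_tensor_sum => a1 a2; rewrite -(comul_counitl (bialg_coalgebra hK)).
  rewrite linear_tensor_sum //.
  apply: eq_tensor_sum => h1 h2; rewrite tensor_counitE -scalerA.
  by rewrite (linear_scale (f := fun x => x ⊗ _)) // (linear_scale (f := tens a2)).
- move: x; apply: eq_linear_tensor => // a h; rewrite sum_tensor_comul //.
  rewrite tensor_twistE /= tensor_sum_tens //.
  rewrite !(comul_twist (bialg_coalgebra _)) //.
  rewrite linear_tensor_sum //; apply: eq_tensor_sum => a1 a2.
  rewrite tensor_sum_tens // linear_tensor_sum //; apply: eq_tensor_sum => h1 h2.
  by rewrite !tensor_sum_tens.
- move: x; apply: (@eq_linear_tensor k B K k^o) => [||a h].
  + exact: scalar_comp tensor_counit_scalar tensor_twist_linear.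
  + exact: tensor_counit_scalar.
  by rewrite tensor_twistE !tensor_counitE !(counit_twist (bialg_coalgebra _)).
Qed.

Lemma tensor_bialgebra : is_hom_bialgebra T.
Proof.
split=> [||x y||x y|].
- exact: tensor_algebra.
- exact: tensor_coalgebra.
- move: x; apply: eq_linear_tensor => // a h.
  move: y; apply: eq_linear_tensor => // b g.
  rewrite sum_tensor_comul // tensor_mulE /= !tensor_sum_tens //.
  rewrite !comul_mul // linear_tensor_sum //.
  apply: eq_tensor_sum => a1 a2.
  under [RHS]eq_tensor_sum => h1 h2 do rewrite linear_tensor_sum //.
  rewrite linear_tensor_sum // [RHS]exchange_tensor_sum.
  apply: eq_tensor_sum => b1 b2; rewrite tensor_sum_tens // linear_tensor_sum //.
  apply: eq_tensor_sum => h1 h2; rewrite !linear_tensor_sum //.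
  by apply: eq_tensor_sum => g1 g2; rewrite !tensor_sum_tens.
- by rewrite /= tensor_sum_tens // !comul_unit // !tensor_sum_tens.
- move: x; apply: (@eq_linear_tensor k B K k^o) => [||a h].
  + exact: scalar_comp tensor_counit_scalar (linear_binl _ tensor_mul_bilinear (@linear_id _ _)).
  + exact: scalar_mull tensor_counit_scalar.
  move: y; apply: (@eq_linear_tensor k B K k^o) => [||b g].
  + exact: scalar_comp tensor_counit_scalar (linear_binr _ tensor_mul_bilinear (@linear_id _ _)).
  + exact: scalar_mulr tensor_counit_scalar.
  by rewrite tensor_mulE !tensor_counitE !counit_mul // mulrACA.
- by rewrite tensor_counitE !counit_unit // mulr1.
Qed.

End TensorBialgebra.

Section Transport.
Variables (k : fieldType) (T X : hom_ops k) (f : T -> X) (g : X -> T).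
Hypotheses (hT : is_hom_bialgebra T) (lf : is_linear f).
Hypotheses (fK : cancel f g) (gK : cancel g f).
Hypothesis f_twist : forall x, twist (f x) = f (twist x).
Hypothesis f_twistV : forall x, twistV (f x) = f (twistV x).
Hypothesis f_mul : forall x y, hmul (f x) (f y) = f (hmul x y).
Hypothesis f_unit : hunit X = f (hunit T).
Hypothesis f_comul : forall x, comul (f x) = \sw_(y, z <- comul x) (f y ⊗ f z).
Hypothesis f_counit : forall x, counit (f x) = counit x.

Let all_f (P : X -> Prop) : (forall x, P (f x)) -> forall x, P x.
Proof. by move=> Pf x; rewrite -(gK x). Qed.

Lemma sum_comul_transport (W : lmodType k) (F : X -> X -> W) x :
  is_bilinear F ->
  \sw_(y, z <- comul (f x)) F y z = \sw_(y, z <- comul x) F (f y) (f z).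
Proof.
move=> bF; rewrite f_comul linear_tensor_sum //.
by apply: eq_tensor_sum => y z; rewrite tensor_sum_tens.
Qed.

(** [f] is onto, so each law of [X] need only be checked on images, where it is the image of the law
    of [T]. In [hom_ops] the inverse twist is a separate field, whence the separate hypothesis
    [f_twistV]. *)
Lemma hom_bialgebra_transport : is_hom_bialgebra X.
Proof.
(* Linearity is not checked on images: each operation of [X] is instead expressed through [g] and
   inherits linearity from [T]. *)
have lg : is_linear g.
  by move=> a x y; apply: (can_inj fK); rewrite lf !gK.
have twistE x : twist x = f (twist (g x)) by rewrite -f_twist gK.
have twistVE x : twistV x = f (twistV (g x)) by rewrite -f_twistV gK.
have mulE x y : hmul x y = f (hmul (g x) (g y)) by rewrite -f_mul !gK.
have comulE x : comul x = \sw_(y, z <- comul (g x)) (f y ⊗ f z).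
  by rewrite -f_comul gK.
have counitE x : counit x = counit (g x) by rewrite -f_counit gK.
have l_twist : is_linear (@twist k X).
  by move=> a x y; rewrite !twistE lg (twist_linear hT) lf.
have l_twistV : is_linear (@twistV k X).
  by move=> a x y; rewrite !twistVE lg (twistV_linear hT) lf.
have aut : is_automorphism (@twist k X) twistV.
  split=> //; apply: all_f => x.
    by rewrite f_twist f_twistV (twistK hT).
  by rewrite f_twistV f_twist (twistVK hT).
have l_mul : is_bilinear (@hmul k X).
  by split=> y a x z; rewrite !mulE lg ?(hmul_bilinear hT).1 ?(hmul_bilinear hT).2 lf.
have l_counit : scalar (@counit k X).
  by move=> a x y; rewrite !counitE lg (counit_scalar hT).
have l_comul : is_linear (@comul k X).
  have l : is_linear (fun x => \sw_(y, z <- comul (g x)) (f y ⊗ f z)) by [].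
  by move=> a x y; rewrite !comulE l.
have alg := bialg_algebra hT; have coalg := bialg_coalgebra hT.
split=> [||x y||x y|].
- split=> //.
  + apply: all_f => x; apply: all_f => y; apply: all_f => z.
    by rewrite !f_twist !f_mul (mul_hom_assoc alg).
  + by apply: all_f => x; rewrite f_unit f_mul f_twist (mul_unitr alg).
  + by apply: all_f => x; rewrite f_unit f_mul f_twist (mul_unitl alg).
  + apply: all_f => x; apply: all_f => y.
    by rewrite !f_twist !f_mul f_twist (twist_mul alg).
  + by rewrite f_unit f_twist (twist_unit alg).
- split=> //.
  + apply: all_f => x; rewrite !sum_comul_transport //.
    under [LHS]eq_tensor_sum => y z do rewrite sum_comul_transport // f_twistV.
    under [RHS]eq_tensor_sum => y z do rewrite sum_comul_transport // f_twistV.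
    by rewrite (@sum_comul_hom_coassoc _ _ hT _ (fun x y z => f x ⊗ (f y ⊗ f z))).
  + apply: all_f => x; rewrite f_twistV -(comul_counitr coalg).
    rewrite sum_comul_transport // linear_tensor_sum //.
    by apply: eq_tensor_sum => y z; rewrite f_counit (linear_scale lf).
  + apply: all_f => x; rewrite f_twistV -(comul_counitl coalg).
    rewrite sum_comul_transport // linear_tensor_sum //.
    by apply: eq_tensor_sum => y z; rewrite f_counit (linear_scale lf).
  + apply: all_f => x; rewrite sum_comul_transport // f_twist f_comul.
    rewrite (comul_twist coalg) linear_tensor_sum //.
    by apply: eq_tensor_sum => y z; rewrite tensor_sum_tens // !f_twist.
  + by apply: all_f => x; rewrite f_twist !f_counit (counit_twist coalg).
- move: x y; apply: all_f => x; apply: all_f => y.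
  rewrite f_mul f_comul (comul_mul hT) linear_tensor_sum //.
  rewrite sum_comul_transport //; apply: eq_tensor_sum => x1 x2.
  rewrite linear_tensor_sum // sum_comul_transport //.
  by apply: eq_tensor_sum => y1 y2; rewrite tensor_sum_tens // !f_mul.
- by rewrite f_unit f_comul (comul_unit hT) tensor_sum_tens.
- move: x y; apply: all_f => x; apply: all_f => y.
  by rewrite f_mul !f_counit (counit_mul hT).
- by rewrite f_unit f_counit (counit_unit hT).
Qed.

End Transport.

(** * The bicrossproduct of the adjoint action and coaction *)

Section AdjointBicrossproduct.
Variables (k : fieldType) (H : hom_ops k) (S : H -> H).
Hypotheses (hH : is_hom_bialgebra H) (hS : is_antipode H S).
Implicit Types (a b c h g t : H) (W V : lmodType k).

Hint Resolve antipode_is_linear sad_bilinear sco_linear : linear_db.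

Local Notation K := (hop H).
Local Notation X := (bicross (adj_act S) (adj_coact S)).

Lemma adj_act_bilinear : @is_bilinear k H H H (adj_act S).
Proof.
by split=> y a x z; rewrite !(adj_actE hH hS);
  [rewrite (sad_bilinear hH hS).1|rewrite (sad_bilinear hH hS).2];
  rewrite (twist_linear hH).
Qed.

(* [hcoact], and [bmul], [bcomul], [tmul], ... below, restate over [H] operations
   that the definitions type over [hop H]: the carriers agree only up to
   conversion, which the syntactic search of [lin] does not see through. *)
Definition hcoact h : (H ⊗ H)%type := adj_coact S h.

Lemma sum_hcoact W (F : H -> H -> W) h : is_bilinear F ->
  \sw_(p, q <- hcoact h) F p q =
  \sw_(p, q <- sco S h) F (twistV p) (twistV q).
Proof. exact: sum_adj_coact. Qed.

Lemma hcoactE h : hcoact h = \sw_(p, q <- sco S h) (twistV p ⊗ twistV q).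
Proof. rewrite -(sum_hcoact (F := fun x y => x ⊗ y)) //; exact: tensor_span. Qed.

Lemma hcoact_linear : is_linear hcoact.
Proof.
have l : is_linear (fun h => \sw_(p, q <- sco S h) (twistV p ⊗ twistV q)) by [].
by move=> a x y; rewrite !hcoactE l.
Qed.

(** Since [twist] commutes with [sad] and [⊙], each Hom-law is the ordinary law for [sad] under a
    power of [twist]. *)
Lemma adj_module_algebra : is_hom_module_algebra K H (adj_act S).
Proof.
have aut := alg_twist_aut (bialg_algebra hH).
split=> [||h a b|h].
- exact: bialg_algebra.
- split=> [//||h g a|a|h a]; first exact: adj_act_bilinear.
  + rewrite /= !(adj_actE hH hS) (hmulE hH) -!(twist_sad hH hS).
    by rewrite (sad_mul hH hS).
  + by rewrite (adj_actE hH hS) (sad_unitl hH hS).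
  + by rewrite !(adj_actE hH hS) (twist_sad hH hS).
- rewrite (adj_actE hH hS) (hmulE hH) (twist_smul hH) (sad_smul hH hS).
  rewrite (linear_tensor_sum _ _ (twist_linear hH)) /= (sum_comul hH) /=.
    apply: eq_tensor_sum => x y.
    rewrite !(adj_actE hH hS) (hmulE hH) !(twist_sad hH hS).
    by rewrite !(twistVK hH).
  have lA := adj_act_bilinear; lin.
- by rewrite (adj_actE hH hS) (sad_unitr hH hS) (linear_scale (twist_linear hH))
    (twist_unit (bialg_algebra hH)).
Qed.

(** Each mixed law is the law of [sco] with [F] chosen to carry the powers of [twistV] that pile up
    on the legs. *)
Lemma adj_comodule_coalgebra : is_hom_comodule_coalgebra H K (adj_coact S).
Proof.
have lc := hcoact_linear.
have aut := alg_twist_aut (bialg_algebra hH).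
have [_ coalgK _ _ _ _] := hop_bialgebra hH.
have comod_comul h :
    \sw_(p, q <- hcoact h) \sw_(x, y <- comul q) (twistV p ⊗ (x ⊗ y)) =
    \sw_(p, q <- hcoact h) \sw_(x, y <- hcoact p)
      (x ⊗ (y ⊗ twistV q)).
  rewrite !sum_hcoact //.
  under [LHS]eq_tensor_sum => p q do
    rewrite (sum_comul hH) // (sum_scomul_twistV hH) //.
  under [RHS]eq_tensor_sum => p q do
    rewrite sum_hcoact // (sum_sco_twistV hH hS) //.
  exact: (@sum_sco_comul _ _ _ hH hS _ (fun x y z => twistV (twistV x) ⊗
    (twistV (twistV y) ⊗ twistV (twistV z)))).
have coact_tw h : hcoact (twist h) =
    \sw_(p, q <- hcoact h) (twist p ⊗ twist q).
  rewrite sum_hcoact // hcoactE (sum_sco_twist hH hS) //.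
  by apply: eq_tensor_sum => p q; rewrite !(twistK hH) !(twistVK hH).
have coalgmul c :
    \sw_(p, q <- hcoact c) \sw_(x, y <- comul p) (x ⊗ (y ⊗ q)) =
    \sw_(c1, c2 <- comul c) \sw_(p, q <- hcoact c1)
      \sw_(p', q' <- hcoact c2) (p ⊗ (p' ⊗ hmul q q')).
  rewrite sum_hcoact // (sum_comul hH) //.
  under [LHS]eq_tensor_sum => p q do
    rewrite (sum_comul hH) // (sum_scomul_twistV hH) //.
  under [RHS]eq_tensor_sum => p q.
    rewrite sum_hcoact // (sum_sco_twistV hH hS) //.
    under eq_tensor_sum => x y.
      rewrite sum_hcoact // (sum_sco_twistV hH hS) //.
      under eq_tensor_sum => z w do
        rewrite (hmulE hH) !(twist_smul hH) !(twistVK hH) -(twistV_smul hH).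
      over.
    over.
  by rewrite (@sum_scomul_sco _ _ _ hH hS _ (fun x y z => twistV (twistV x) ⊗
    (twistV (twistV y) ⊗ twistV z))).
split=> [//||//|h].
- split=> [//||//|h|//]; first exact: hcoact_linear.
  rewrite /= sum_hcoact /=; last by lin.
  under eq_tensor_sum do rewrite (counit_twistV hH).
  exact: (sum_sco_counit hH hS).
- rewrite /= sum_hcoact /=; last by lin.
  under eq_tensor_sum do rewrite (counit_twistV hH).
  by rewrite (sum_counit_sco hH hS) // (twistV_unit hH).
Qed.

Hint Resolve hcoact_linear adj_act_bilinear : linear_db.

Definition bmul (x y : H ⊗ H) : (H ⊗ H)%type := @hmul k X x y.
Definition bcomul (x : H ⊗ H) : ((H ⊗ H) ⊗ (H ⊗ H))%type := @comul k X x.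

Lemma bmul_bilinear : is_bilinear bmul.
Proof.
have -> : bmul = fun x y => \sw_(a, h <- x) \sw_(b, g <- y)
    \sw_(h1, h2 <- @comul k H h)
      (hmul a (adj_act S h1 (twistV b)) ⊗ @hmul k H g (@twist k H h2)).
  by [].
by [].
Qed.

(** Up to one [twist] on each leg, this is the ordinary smash product; [g] precedes [y] because the
    second factor is H^op. *)
Lemma bmulE a h b g :
  bmul (a ⊗ h) (b ⊗ g) =
  \sw_(x, y <- δ h) (twist (a ⊙ sad S x b) ⊗ twist (g ⊙ y)).
Proof.
rewrite -[LHS]/(\sw_(a, h <- a ⊗ h) \sw_(b, g <- b ⊗ g)
    \sw_(h1, h2 <- @comul k H h)
      (hmul a (adj_act S h1 (twistV b)) ⊗ @hmul k H g (@twist k H h2)) : (H ⊗ H)%type).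
rewrite !tensor_sum_tens // (sum_comul hH) //.
apply: eq_tensor_sum => x y.
rewrite (adj_actE hH hS) (twist_sad hH hS) !(twistVK hH).
by rewrite !(hmulE hH).
Qed.

Lemma bcomul_linear : is_linear bcomul.
Proof.
have -> : bcomul = fun x => \sw_(a, h <- x) \sw_(a1, a2 <- comul a)
    \sw_(h1, h2 <- comul h) \sw_(p, q <- hcoact h1)
    ((a1 ⊗ @twist k H p) ⊗ (hmul (twistV a2) q ⊗ h2)).
  by [].
by [].
Qed.

(** Up to one [twistV] on each leg, this is the ordinary smash coproduct. *)
Lemma bcomulE a h :
  bcomul (a ⊗ h) = \sw_(a1, a2 <- δ a) \sw_(h1, h2 <- δ h)
    \sw_(p, q <- sco S h1)
      ((twistV a1 ⊗ twistV p) ⊗ (twistV (a2 ⊙ q) ⊗ twistV h2)).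
Proof.
rewrite -[LHS]/(\sw_(a, h <- a ⊗ h) \sw_(a1, a2 <- comul a)
    \sw_(h1, h2 <- comul h) \sw_(p, q <- hcoact h1)
    ((a1 ⊗ @twist k H p) ⊗ (hmul (twistV a2) q ⊗ h2))).
rewrite tensor_sum_tens // (sum_comul hH) //; apply: eq_tensor_sum => a1 a2.
rewrite (sum_comul hH) //; apply: eq_tensor_sum => h1 h2.
rewrite sum_hcoact // (sum_sco_twistV hH hS) //; apply: eq_tensor_sum => p q.
rewrite (twistVK hH) (hmulE hH) (twist_smul hH) !(twistVK hH).
by rewrite -(twistV_smul hH).
Qed.

Hint Resolve bmul_bilinear bcomul_linear : linear_db.

(** * The isomorphism from the tensor product bialgebra, and its inverse *)

Definition bic_of_tensor (t : H ⊗ H) : (H ⊗ H)%type :=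
  \sw_(a, h <- t) \sw_(x, y <- δ h) (a ⊙ x ⊗ y).
Definition tensor_of_bic (t : H ⊗ H) : (H ⊗ H)%type :=
  \sw_(a, h <- t) \sw_(x, y <- δ h) (a ⊙ S x ⊗ y).

Lemma bic_of_tensor_linear : is_linear bic_of_tensor.
Proof. by rewrite /bic_of_tensor. Qed.

Lemma tensor_of_bic_linear : is_linear tensor_of_bic.
Proof. by rewrite /tensor_of_bic. Qed.

Hint Resolve bic_of_tensor_linear tensor_of_bic_linear : linear_db.

Lemma bic_of_tensorE a h :
  bic_of_tensor (a ⊗ h) = \sw_(x, y <- δ h) (a ⊙ x ⊗ y).
Proof. by rewrite /bic_of_tensor tensor_sum_tens. Qed.

Lemma bic_of_tensorK : cancel bic_of_tensor tensor_of_bic.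
Proof.
apply: (eq_linear_tensor (W := (H ⊗ H)%type)
  (f := fun u => tensor_of_bic (bic_of_tensor u)) (g := id)) => // a h.
rewrite bic_of_tensorE linear_tensor_sum //.
under eq_tensor_sum do rewrite /tensor_of_bic tensor_sum_tens //.
rewrite -(@sum_scomul_coassoc _ _ hH _ (fun x z y => a ⊙ x ⊙ S z ⊗ y)) //.
under eq_tensor_sum => x y.
  under eq_tensor_sum do rewrite -(smulA hH).
  rewrite (@sum_antipoder _ _ _ hH hS _ (fun x => a ⊙ x ⊗ y)) // (smulu hH).
  over.
by rewrite (sum_scomul_counitl hH).
Qed.

Lemma tensor_of_bicK : cancel tensor_of_bic bic_of_tensor.
Proof.
apply: (eq_linear_tensor (W := (H ⊗ H)%type)
  (f := fun u => bic_of_tensor (tensor_of_bic u)) (g := id)) => // a h.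
rewrite /tensor_of_bic tensor_sum_tens // linear_tensor_sum //.
under eq_tensor_sum do rewrite bic_of_tensorE.
rewrite -(@sum_scomul_coassoc _ _ hH _ (fun x z y => a ⊙ S x ⊙ z ⊗ y)) //.
under eq_tensor_sum => x y.
  under eq_tensor_sum do rewrite -(smulA hH).
  rewrite (@sum_antipodel _ _ _ hH hS _ (fun x => a ⊙ x ⊗ y)) // (smulu hH).
  over.
by rewrite (sum_scomul_counitl hH).
Qed.

Definition ttwist (t : H ⊗ H) : (H ⊗ H)%type := \sw_(a, h <- t) (twist a ⊗ twist h).
Definition ttwistV (t : H ⊗ H) : (H ⊗ H)%type :=
  \sw_(a, h <- t) (twistV a ⊗ twistV h).

Lemma ttwist_linear : is_linear ttwist.
Proof. by rewrite /ttwist. Qed.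

Lemma ttwistV_linear : is_linear ttwistV.
Proof. by rewrite /ttwistV. Qed.

Hint Resolve ttwist_linear ttwistV_linear : linear_db.

Lemma ttwistE a h : ttwist (a ⊗ h) = twist a ⊗ twist h.
Proof. by rewrite /ttwist tensor_sum_tens. Qed.

Lemma ttwistVE a h : ttwistV (a ⊗ h) = twistV a ⊗ twistV h.
Proof. by rewrite /ttwistV tensor_sum_tens. Qed.

Lemma bic_of_tensor_twist u : ttwist (bic_of_tensor u) = bic_of_tensor (ttwist u).
Proof.
move: u; apply: (eq_linear_tensor (f := fun u => ttwist (bic_of_tensor u))) => // a h.
rewrite ttwistE !bic_of_tensorE linear_tensor_sum // (sum_scomul_twist hH) //.
by apply: eq_tensor_sum => x y; rewrite ttwistE (twist_smul hH).
Qed.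

Lemma bic_of_tensor_twistV u :
  ttwistV (bic_of_tensor u) = bic_of_tensor (ttwistV u).
Proof.
move: u; apply: (eq_linear_tensor (f := fun u => ttwistV (bic_of_tensor u))) => // a h.
rewrite ttwistVE !bic_of_tensorE linear_tensor_sum // (sum_scomul_twistV hH) //.
by apply: eq_tensor_sum => x y; rewrite ttwistVE (twistV_smul hH).
Qed.

Definition tmul (x y : H ⊗ H) : (H ⊗ H)%type :=
  \sw_(a, h <- x) \sw_(b, g <- y) (hmul a b ⊗ hmul g h).

(** The left leg of the product is a h1 sad(h2, b g1), which innerness turns into a b g1 h1: the
    left leg obtained from ab ⊗ gh. *)
Lemma bic_of_tensor_mul x y :
  bmul (bic_of_tensor x) (bic_of_tensor y) = bic_of_tensor (tmul x y).
Proof.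
have tmul_bil : is_bilinear tmul by rewrite /tmul.
move: x; apply: (eq_linear_tensor
  (f := fun x => bmul (bic_of_tensor x) (bic_of_tensor y))) => // a h.
move: y; apply: (eq_linear_tensor
  (f := fun y => bmul (bic_of_tensor (a ⊗ h)) (bic_of_tensor y))) => // b g.
rewrite /tmul !tensor_sum_tens // !bic_of_tensorE.
rewrite !(hmulE hH) (sum_scomul_twist hH) // (sum_scomul_mul hH) //.
rewrite linear_tensor_sum //; apply: eq_tensor_sum => z w.
rewrite (linear_tensor_sum (L := fun x => bmul x (b ⊙ z ⊗ w))) //.
under eq_tensor_sum do rewrite bmulE.
rewrite -(@sum_scomul_coassoc _ _ hH _ (fun x u v =>
  twist (a ⊙ x ⊙ sad S u (b ⊙ z)) ⊗ twist (w ⊙ v))) //.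
apply: eq_tensor_sum => u v.
under eq_tensor_sum do rewrite -(smulA hH).
rewrite -(linear_tensor_sum (L := fun x => twist (a ⊙ x) ⊗ _)) //.
by rewrite (sum_smul_sad hH hS) -(twist_smul hH) !(smulA hH).
Qed.

Definition tcomul (x : H ⊗ H) : ((H ⊗ H) ⊗ (H ⊗ H))%type :=
  \sw_(a, h <- x) \sw_(a1, a2 <- comul a) \sw_(h1, h2 <- comul h)
    ((a1 ⊗ h1) ⊗ (a2 ⊗ h2)).

Lemma tcomul_linear : is_linear tcomul.
Proof. by rewrite /tcomul. Qed.

Hint Resolve tcomul_linear : linear_db.

Lemma sum_tcomul W (F : (H ⊗ H)%type -> (H ⊗ H)%type -> W) a h :
  is_bilinear F ->
  \sw_(x, y <- tcomul (a ⊗ h)) F x y =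
  \sw_(a1, a2 <- δ a) \sw_(h1, h2 <- δ h)
    F (twistV a1 ⊗ twistV h1) (twistV a2 ⊗ twistV h2).
Proof.
move=> bF; rewrite /tcomul tensor_sum_tens // linear_tensor_sum //.
rewrite (sum_comul hH) //; apply: eq_tensor_sum => a1 a2.
rewrite linear_tensor_sum // (sum_comul hH) //; apply: eq_tensor_sum => h1 h2.
by rewrite tensor_sum_tens.
Qed.

Lemma bic_of_tensorVE a h :
  bic_of_tensor (twistV a ⊗ twistV h) =
  \sw_(x, y <- δ h) (twistV (a ⊙ x) ⊗ twistV y).
Proof.
rewrite bic_of_tensorE (sum_scomul_twistV hH) //.
by apply: eq_tensor_sum => x y; rewrite (twistV_smul hH).
Qed.

(** The coproduct of a h1 ⊗ h2 contains the factor h2 next to the coaction of h3; [sum_smul_sco]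
    absorbs it, leaving (a1 h1 ⊗ h2) ⊗ (a2 h3 ⊗ h4). *)
Lemma bic_of_tensor_comul u :
  bcomul (bic_of_tensor u) =
  \sw_(x, y <- tcomul u) (bic_of_tensor x ⊗ bic_of_tensor y).
Proof.
move: u; apply: (eq_linear_tensor
  (f := fun u => bcomul (bic_of_tensor u))) => // a h.
rewrite sum_tcomul // bic_of_tensorE linear_tensor_sum //.
under eq_tensor_sum => x y do rewrite bcomulE (sum_scomul_mul hH) //.
rewrite [LHS]exchange_tensor_sum; apply: eq_tensor_sum => a1 a2.
under [RHS]eq_tensor_sum => h1 h2.
  rewrite !bic_of_tensorVE (linear_tensor_sum (L := fun x => x ⊗ _)) //.
  under eq_tensor_sum do rewrite linear_tensor_sum //.
  over.
rewrite !(sum_scomul_coassoc4 hH) //.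
apply: eq_tensor_sum => x s; apply: eq_tensor_sum => t w.
under eq_tensor_sum do under eq_tensor_sum do rewrite -(smulA hH).
by rewrite (@sum_smul_sco _ _ _ hH hS _ (fun p q =>
  (twistV (a1 ⊙ x) ⊗ twistV p) ⊗ (twistV (a2 ⊙ q) ⊗ twistV w))).
Qed.

Definition tcounit : (H ⊗ H)%type -> k^o :=
  tensor_sum (W := k^o) (fun a h : H => counit a * counit h).

Lemma tcounit_linear : is_linear tcounit.
Proof. exact: tensor_counit_scalar hH hH. Qed.

Lemma tcounitE a h : tcounit (a ⊗ h) = counit a * counit h.
Proof. exact: (@tensor_counitE k H H hH hH a h). Qed.

Lemma bic_of_tensor_counit u : tcounit (bic_of_tensor u) = tcounit u.
Proof.
have lt := tcounit_linear.
move: u; apply: (eq_linear_tensor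
  (f := fun u => tcounit (bic_of_tensor u))) => // a h.
rewrite bic_of_tensorE linear_tensor_sum // tcounitE.
rewrite -(@sum_scomul_counitl _ _ hH k^o (fun y => counit a * counit y)).
  apply: eq_tensor_sum => x y.
  by rewrite tcounitE (counit_smul hH) -mulrA mulrCA.
exact: scalar_mulr (counit_scalar hH).
Qed.

Lemma bicross_bialgebra : is_hom_bialgebra X.
Proof.
apply: (@hom_bialgebra_transport k (tensor_ops H K) X bic_of_tensor tensor_of_bic).
- exact: tensor_bialgebra hH (hop_bialgebra hH).
- exact: bic_of_tensor_linear.
- exact: bic_of_tensorK.
- exact: tensor_of_bicK.
- exact: bic_of_tensor_twist.
- exact: bic_of_tensor_twistV.
- exact: bic_of_tensor_mul.
- rewrite -[RHS]/(bic_of_tensor (hunit H ⊗ hunit H)) bic_of_tensorE.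
  by rewrite (sum_scomul_unit hH) // (smulu hH).
- exact: bic_of_tensor_comul.
- exact: bic_of_tensor_counit.
Qed.

(** * The antipode laws of the bicrossproduct *)

Section BicrossAntipode.
Variable SK : H -> H.
Hypothesis hSK : is_antipode K SK.

Lemma hop_antipode_linear : is_linear SK.
Proof. exact: antipode_linear hSK. Qed.

Hint Resolve hop_antipode_linear : linear_db.

Lemma hop_antipode_twistV a : SK (twistV a) = twistV (SK a).
Proof. exact: (antipode_twistV (hop_bialgebra hH) hSK). Qed.

(** Read in [H], the antipode law of [hop H] is that of a skew antipode: h2 SK(h1) = ε(h) 1. The
    proof is by conversion, since [hop] only swaps the arguments of the product. *)
Lemma sum_hop_antipodel W (F : H -> W) c : is_linear F ->
  \sw_(x, y <- δ c) F (y ⊙ SK x) = counit c *: F (hunit H).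
Proof. exact: (@sum_antipodel k K SK (hop_bialgebra hH) hSK W F). Qed.

Lemma sum_hop_antipoder W (F : H -> W) c : is_linear F ->
  \sw_(x, y <- δ c) F (SK y ⊙ x) = counit c *: F (hunit H).
Proof. exact: (@sum_antipoder k K SK (hop_bialgebra hH) hSK W F). Qed.

Definition bantipode (x : H ⊗ H) : (H ⊗ H)%type :=
  @bicross_antipode k H K (adj_act S) (adj_coact S) S SK x.

Lemma bantipode_unfold (x : H ⊗ H) : bantipode x =
  \sw_(a, h <- x) \sw_(p, q <- hcoact h) bmul (hunit H ⊗ SK p)
    (S (hmul (twistV (twistV a)) (twistV q)) ⊗ hunit H).
Proof. by []. Qed.

Lemma bantipode_linear : is_linear bantipode.
Proof.
have l : is_linear (fun x => \sw_(a, h <- x) \sw_(p, q <- hcoact h)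
  bmul (hunit H ⊗ SK p)
    (S (hmul (twistV (twistV a)) (twistV q)) ⊗ hunit H)) by [].
by move=> a x y; rewrite !bantipode_unfold l.
Qed.

Hint Resolve bantipode_linear : linear_db.

Lemma bantipodeE a h : bantipode (a ⊗ h) =
  \sw_(p, q <- sco S h)
    bmul (hunit H ⊗ twistV (SK p)) (twistV (S (a ⊙ q)) ⊗ hunit H).
Proof.
rewrite bantipode_unfold tensor_sum_tens // sum_hcoact //.
apply: eq_tensor_sum => p q.
rewrite (hmulE hH) (twist_smul hH) !(twistVK hH) -(twistV_smul hH).
by rewrite (antipode_twistV hH hS) hop_antipode_twistV.
Qed.

(** The isomorphism contributes a factor h1 just before the coaction of h2 in the argument of [S],
    and [sum_smul_sco] removes both. *)
Lemma bantipode_bic_of_tensor a h : bantipode (bic_of_tensor (a ⊗ h)) =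
  \sw_(x, y <- δ h)
    bmul (hunit H ⊗ twistV (SK x)) (twistV (S (a ⊙ y)) ⊗ hunit H).
Proof.
rewrite bic_of_tensorE linear_tensor_sum //.
under eq_tensor_sum do rewrite bantipodeE.
under eq_tensor_sum do under eq_tensor_sum do rewrite -(smulA hH).
by rewrite (@sum_smul_sco _ _ _ hH hS _ (fun x y =>
    bmul (hunit H ⊗ twistV (SK x)) (twistV (S (a ⊙ y)) ⊗ hunit H))).
Qed.

Lemma bmul_unitr a g b : bmul (a ⊗ hunit H) (b ⊗ g) = twist (a ⊙ b) ⊗ twist g.
Proof.
by rewrite bmulE (sum_scomul_unit hH) // (sad_unitl hH hS) (smulu hH).
Qed.

Lemma bmul_unitl a h g : bmul (a ⊗ h) (hunit H ⊗ g) = twist a ⊗ twist (g ⊙ h).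
Proof.
rewrite bmulE -[RHS](@sum_scomul_counitl _ _ hH _
  (fun y => twist a ⊗ twist (g ⊙ y))) //.
apply: eq_tensor_sum => x y; rewrite (sad_unitr hH hS).
rewrite (linear_scale (f := fun x => twist (a ⊙ x) ⊗ twist (g ⊙ y))) //.
by rewrite (smulu hH).
Qed.

Lemma bmulA (x y z : H ⊗ H) :
  bmul (ttwist x) (bmul y z) = bmul (bmul x y) (ttwist z).
Proof. exact: (mul_hom_assoc (bialg_algebra bicross_bialgebra)). Qed.

(** Regrouping brings [b] next to [c]; in the antipode law these are S(a1 h2) and a2 h3, which then
    contract. *)
Lemma bmul_rearrangel g b c h :
  bmul (bmul (hunit H ⊗ twistV g) (twistV b ⊗ hunit H)) (c ⊗ h) =
  bmul (hunit H ⊗ g) (b ⊙ c ⊗ h).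
Proof.
(* Hom-associativity only regroups when the outer factor is a twist. *)
have -> : c ⊗ h = ttwist (twistV c ⊗ twistV h) by rewrite ttwistE !(twistVK hH).
rewrite -bmulA ttwistE bmul_unitr (twist_unit (bialg_algebra hH)).
by rewrite !(twist_smul hH) !(twistVK hH).
Qed.

Lemma bmul_rearranger c h g b :
  bmul (c ⊗ h) (bmul (hunit H ⊗ twistV g) (twistV b ⊗ hunit H)) =
  bmul (c ⊗ (g ⊙ h)) (b ⊗ hunit H).
Proof.
have -> : c ⊗ h = ttwist (twistV c ⊗ twistV h) by rewrite ttwistE !(twistVK hH).
rewrite bmulA ttwistE bmul_unitl (twist_unit (bialg_algebra hH)).
by rewrite !(twist_smul hH) !(twistVK hH).
Qed.

Lemma sum_bcomul_bic_of_tensor W (F : (H ⊗ H)%type -> (H ⊗ H)%type -> W) a h :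
  is_bilinear F ->
  \sw_(x, y <- bcomul (bic_of_tensor (a ⊗ h))) F x y =
  \sw_(a1, a2 <- δ a) \sw_(h1, h2 <- δ h)
    F (bic_of_tensor (twistV a1 ⊗ twistV h1))
      (bic_of_tensor (twistV a2 ⊗ twistV h2)).
Proof.
move=> bF; rewrite bic_of_tensor_comul linear_tensor_sum //.
rewrite sum_tcomul //; do 2! apply: eq_tensor_sum => ? ?.
by rewrite tensor_sum_tens.
Qed.

Lemma bantipode_bic_of_tensorV a h :
  bantipode (bic_of_tensor (twistV a ⊗ twistV h)) =
  \sw_(x, y <- δ h) bmul (hunit H ⊗ twistV (twistV (SK x)))
    (twistV (twistV (S (a ⊙ y))) ⊗ hunit H).
Proof.
rewrite bantipode_bic_of_tensor (sum_scomul_twistV hH) //.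
apply: eq_tensor_sum => x y.
by rewrite hop_antipode_twistV -(twistV_smul hH) (antipode_twistV hH hS).
Qed.

Lemma bantipode_twist u : bantipode (ttwist u) = ttwist (bantipode u).
Proof.
move: u; apply: (eq_linear_tensor (f := fun u => bantipode (ttwist u))) => // a h.
rewrite ttwistE !bantipodeE (linear_tensor_sum _ _ ttwist_linear).
rewrite (sum_sco_twist hH hS) //.
apply: eq_tensor_sum => p q.
have -> x y : ttwist (bmul x y) = bmul (ttwist x) (ttwist y).
  exact: (twist_mul (bialg_algebra bicross_bialgebra)).
rewrite !ttwistE (twist_unit (bialg_algebra hH)) -(twist_smul hH).
rewrite (antipode_twist hS) -[twistV (SK (twist p))]hop_antipode_twistV.
by rewrite !(twistK hH) !(twistVK hH).
Qed.

Lemma bantipode_mull u :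
  \sw_(x, y <- bcomul u) bmul (bantipode x) y =
  (tcounit u : k) *: (hunit H ⊗ hunit H).
Proof.
have lt := tcounit_linear.
(* Every [u] is an image under the isomorphism, where the antipode is free of the coaction. *)
rewrite -[u]tensor_of_bicK; move: (tensor_of_bic u) => {u}.
apply: (eq_linear_tensor
  (f := fun u => \sw_(x, y <- bcomul (bic_of_tensor u)) bmul (bantipode x) y)
  (g := fun u => (tcounit (bic_of_tensor u) : k) *: (hunit H ⊗ hunit H))) => // [|a h].
  by apply: linear_scalel; apply: scalar_comp lt bic_of_tensor_linear.
rewrite sum_bcomul_bic_of_tensor // bic_of_tensor_counit tcounitE.
(* The full sum is (1 ⊗ SK(h1)) (S(a1 h2) a2 h3 ⊗ h4). Contracting S(p1) p2 for p = a h2 leaves this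
   expression, and the skew antipode law finishes. *)
transitivity (\sw_(u, s <- δ h) (counit a *:
  bmul (hunit H ⊗ twistV (SK u)) (hunit H ⊗ twistV s))); last first.
  under eq_tensor_sum do
    rewrite bmul_unitl -(twistV_smul hH) (twistVK hH) (twist_unit (bialg_algebra hH)).
  rewrite tensor_sum_scaler (@sum_hop_antipodel _ (fun x => hunit H ⊗ x)) //.
  by rewrite scalerA.
under eq_tensor_sum => a1 a2.
  under eq_tensor_sum => h1 h2.
  rewrite bantipode_bic_of_tensorV bic_of_tensorVE.
  rewrite (linear_tensor_sum (L := fun x => bmul x _)) //.
  under eq_tensor_sum => x y do
    (rewrite linear_tensor_sum //; under eq_tensor_sum => z w do
      rewrite bmul_rearrangel -(twistV_smul hH)).
    over.
  rewrite (sum_scomul_coassoc4 hH) //.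
  over.
rewrite exchange_tensor_sum; under eq_tensor_sum => x y.
  rewrite exchange_tensor_sum; under eq_tensor_sum => z w.
    rewrite -(@sum_scomul_mul _ _ hH _ (fun p q => bmul (hunit H ⊗ twistV (SK x))
      (twistV (S p ⊙ q) ⊗ twistV w))) //.
    rewrite (@sum_antipodel _ _ _ hH hS _ (fun p => bmul (hunit H ⊗ twistV (SK x))
      (twistV p ⊗ twistV w))) // (counit_smul hH) (twistV_unit hH) mulrC -scalerA.
    over.
  rewrite (@sum_scomul_counitl _ _ hH _ (fun w => counit a *:
    bmul (hunit H ⊗ twistV (SK x)) (hunit H ⊗ twistV w))) //.
  over.
by [].
Qed.

(** Here the order of contraction is reversed: in (a1 h1 ⊗ SK(h3) h2) (S(a2 h4) ⊗ 1) the skew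
    antipode law acts first, and what remains is p1 S(p2) for p = a h. *)
Lemma bantipode_mulr u :
  \sw_(x, y <- bcomul u) bmul x (bantipode y) =
  (tcounit u : k) *: (hunit H ⊗ hunit H).
Proof.
have lt := tcounit_linear.
rewrite -[u]tensor_of_bicK; move: (tensor_of_bic u) => {u}.
apply: (eq_linear_tensor
  (f := fun u => \sw_(x, y <- bcomul (bic_of_tensor u)) bmul x (bantipode y))
  (g := fun u => (tcounit (bic_of_tensor u) : k) *: (hunit H ⊗ hunit H))) => // [|a h].
  by apply: linear_scalel; apply: scalar_comp lt bic_of_tensor_linear.
rewrite sum_bcomul_bic_of_tensor // bic_of_tensor_counit tcounitE.
transitivity (\sw_(a1, a2 <- δ a) \sw_(u, s <- δ h)
  ((a1 ⊙ u) ⊙ S (a2 ⊙ s) ⊗ hunit H)); last first.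
  rewrite -(@sum_scomul_mul _ _ hH _ (fun p q => p ⊙ S q ⊗ hunit H)) //.
  by rewrite (@sum_antipoder _ _ _ hH hS _ (fun p => p ⊗ hunit H)) // (counit_smul hH).
apply: eq_tensor_sum => a1 a2.
under eq_tensor_sum => h1 h2.
  rewrite bantipode_bic_of_tensorV bic_of_tensorVE.
  rewrite (linear_tensor_sum (L := fun x => bmul x _)) //.
  under eq_tensor_sum => x y do
    (rewrite linear_tensor_sum //; under eq_tensor_sum => z w do
      rewrite bmul_rearranger -(twistV_smul hH)).
  over.
rewrite (sum_scomul_coassoc4 hH) //; apply: eq_tensor_sum => x y.
under eq_tensor_sum => z w do
  rewrite (@sum_hop_antipoder _ (fun p => bmul (twistV (a1 ⊙ x) ⊗ twistV p)
    (twistV (S (a2 ⊙ w)) ⊗ hunit H))) // (twistV_unit hH).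
rewrite (@sum_scomul_counitl _ _ hH _ (fun w => bmul (twistV (a1 ⊙ x) ⊗ hunit H)
    (twistV (S (a2 ⊙ w)) ⊗ hunit H))) //.
rewrite bmul_unitr -(twistV_smul hH) (twistVK hH).
by rewrite (twist_unit (bialg_algebra hH)).
Qed.

Lemma bicross_is_antipode :
  is_antipode X (@bicross_antipode k H K (adj_act S) (adj_coact S) S SK).
Proof.
split.
- exact: bantipode_linear.
- exact: bantipode_twist.
- exact: bantipode_mull.
- exact: bantipode_mulr.
Qed.

End BicrossAntipode.
End AdjointBicrossproduct.

(** An antipode of H^op is a skew antipode of H, such as an inverse of [S] when there is one; [S]
    itself does not supply it in general. It therefore enters as an arbitrary [SK] satisfying the
    antipode laws, and the Hopf structure is asserted for each such [SK]. *)
Theorem theorem3p3 (k : fieldType) (H : hom_ops k) (S : H -> H)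
    (hH : is_hom_hopf H S) :
  [/\ is_hom_module_algebra (hop H) H (adj_act S),
      is_hom_comodule_coalgebra H (hop H) (adj_coact S),
      is_hom_bialgebra (bicross (adj_act S) (adj_coact S)) &
      forall SK : hop H -> hop H, is_antipode (hop H) SK ->
        is_majid_bicrossproduct_hopf (adj_act S) (adj_coact S) S SK].
Proof.
have [hb hS] := hH.
split=> [|||SK hSK].
- exact: adj_module_algebra.
- exact: adj_comodule_coalgebra.
- exact: bicross_bialgebra.
split=> //.
- by split=> //; apply: hop_bialgebra.
- exact: adj_module_algebra.
- exact: adj_comodule_coalgebra.
- by split; [apply: bicross_bialgebra|apply: bicross_is_antipode].
Qed.
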